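(* Let $k<0$ (attractive force) and let $c>0$ be a constant (background charge). Consider the one-dimensional Euler-Poisson system $$\rho_t+(\rho u)_x=0,\qquad u_t+uu_x=kE,\qquad E_x=\rho-c,\qquad x\in\mathbb{R},\ t>0,$$ with initial data $(\rho,u)(x,0)=(\rho_0,u_0)(x)$. It admits a global smooth solution if and only if $$u_0'(\alpha)\ge-\left(1-\frac{\rho_0(\alpha)}{c}\right)\sqrt{-ck}\qquad\forall\,\alpha\in\mathbb{R}.$$ In this case, the density approaches zero exponentially in time, and the velocity gradient $u_x$ remains bounded uniformly in time. If the condition fails, then the solution breaks down in finite time.
   Context: Initial data: $\rho_0,u_0\in C^1(\mathbb{R})$, $\rho_0>0$. Standing assumptions: $\int_{-\infty}^\infty(\rho(\xi,t)-c)\,d\xi=0$, $\rho(\pm\infty,t)=c$, $u(\pm\infty,t)=0$, and $E(x,t)=\int_{-\infty}^x(\rho(\xi,t)-c)\,d\xi$. Characteristics: $\frac{d}{dt}x(\alpha,t)=u(x(\alpha,t),t)$, $x(\alpha,0)=\alpha$. The time behavior of $\rho$ and $u_x$ refers to their evolution along characteristics. A global smooth solution is a classical solution for all $t\ge0$ with $\rho$ and $u_x$ finite along the characteristics; ''breaks down'' means that $\rho$ and $u_x$ become unbounded along a characteristic in finite time.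
   Formalization: The density is shown to approach zero exponentially only along characteristics where the inequality is strict (far-field conditions not assumed); where equality holds it approaches c instead, as ρ=c, u=0 shows. *)

(* Defs.v *)
From Stdlib Require Import Reals.
From Coquelicot Require Import Coquelicot.
Open Scope R_scope.

(* Functions of (x, t) are curried, space variable first.  Only the values at
   times 0 <= t < T matter; T : Rbar, and T = p_infty is the global case. *)

Definition dx (f : R -> R -> R) (x t : R) : R := Derive (fun y => f y t) x.
Definition dt (f : R -> R -> R) (x t : R) : R := Derive (fun s => f x s) t.

Definition C1_line (f : R -> R) : Prop :=
  forall x, ex_derive f x /\ continuous (Derive f) x.

(* Joint continuity on R x [0,T), one-sided in time at t = 0. *)
Definition continuous_strip (T : Rbar) (f : R -> R -> R) : Prop :=
  forall x t, 0 <= t -> Rbar_lt t T ->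
    filterlim (fun p : R * R => f (fst p) (snd p))
      (within (fun p : R * R => 0 <= snd p) (locally (x, t)))
      (locally (f x t)).

(* C^1 regularity on R x [0,T).  The time derivative is required at t > 0 only;
   for solutions its continuity up to t = 0 follows from the equations. *)
Record C1_strip (T : Rbar) (f : R -> R -> R) : Prop := {
  C1_strip_cont : continuous_strip T f;
  C1_strip_ex_dx : forall x t, 0 <= t -> Rbar_lt t T ->
    ex_derive (fun y => f y t) x;
  C1_strip_dx_cont : continuous_strip T (dx f);
  C1_strip_ex_dt : forall x t, 0 < t -> Rbar_lt t T ->
    ex_derive (fun s => f x s) t;
  C1_strip_dt_cont : forall x t, 0 < t -> Rbar_lt t T ->
    continuous (fun p : R * R => dt f (fst p) (snd p)) (x, t)
}.

Definition characteristics (T : Rbar) (u X : R -> R -> R) : Prop :=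
  forall a,
    X a 0 = a /\
    filterlim (X a) (at_right 0) (locally a) /\
    forall t, 0 < t -> Rbar_lt t T -> is_derive (X a) t (u (X a t) t).

(* Classical solution on R x [0,T), together with its characteristics
   X a t = x(alpha, t), all of which live on the whole of [0,T). *)
Record smooth_solution (k c : R) (rho0 u0 : R -> R) (T : Rbar)
    (rho u E X : R -> R -> R) : Prop := {
  sol_rho_C1 : C1_strip T rho;
  sol_u_C1 : C1_strip T u;
  sol_rho_init : forall x, rho x 0 = rho0 x;
  sol_u_init : forall x, u x 0 = u0 x;
  sol_mass : forall x t, 0 < t -> Rbar_lt t T ->
    dt rho x t + dx (fun y s => rho y s * u y s) x t = 0;
  sol_momentum : forall x t, 0 < t -> Rbar_lt t T ->
    dt u x t + u x t * dx u x t = k * E x t;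
  sol_poisson : forall x t, 0 < t -> Rbar_lt t T ->
    is_derive (fun y => E y t) x (rho x t - c);
  sol_char : characteristics T u X
}.

(* The conditions at infinity at one fixed time.  The integral over the line is
   an improper Riemann integral, so conditional convergence is allowed. *)
Definition far_field (c : R) (r v : R -> R) : Prop :=
  is_lim r m_infty c /\ is_lim r p_infty c /\
  is_lim v m_infty 0 /\ is_lim v p_infty 0 /\
  is_RInt_gen (fun x => r x - c)
    (Rbar_locally m_infty) (Rbar_locally p_infty) 0.

Definition standing (c : R) (T : Rbar) (rho u E : R -> R -> R) : Prop :=
  forall t, 0 <= t -> Rbar_lt t T ->
    far_field c (fun x => rho x t) (fun x => u x t) /\
    forall x, is_RInt_gen (fun xi => rho xi t - c)
      (Rbar_locally m_infty) (at_point x) (E x t).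

(* The right-hand side of the threshold condition. *)
Definition critical_slope (k c : R) (rho0 : R -> R) (a : R) : R :=
  - (1 - rho0 a / c) * sqrt (- c * k).

Definition tends_exponentially (f : R -> R) (l : R) : Prop :=
  exists K r, 0 < r /\ forall t, 0 <= t -> Rabs (f t - l) <= K * exp (- r * t).

Definition unbounded_before (T : R) (f : R -> R) : Prop :=
  forall M, exists t, 0 <= t < T /\ M < Rabs (f t).

(* rho and u_x become unbounded along one characteristic as time runs up to T. *)
Definition breaks_down_at (T : R) (rho u X : R -> R -> R) : Prop :=
  exists a, unbounded_before T (fun t => rho (X a t) t) /\
            unbounded_before T (fun t => dx u (X a t) t).

(* Main.v *)
Require Import Defs.
From Stdlib Require Import Reals Lra ClassicalEpsilon FunctionalExtensionality.
From Coquelicot Require Import Coquelicot.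
Open Scope R_scope.

(** Along two characteristics X a and X b the mass between them is conserved, so
    Z = X b - X a solves the linear equation Z'' = w^2 Z + k m with w = sqrt (- c k)
    and a constant m.  Solving it and differentiating in b gives the Jacobian
    J = rho0/c + (1 - rho0/c) cosh (w t) + (u0'/w) sinh (w t) of the flow, together with
    rho J = rho0 and u_x J = J_t.  The growing mode e^{w t} of J has coefficient
    (u0'/w + 1 - rho0/c) / 2, and J stays positive for all times exactly when this is
    nonnegative, which is the threshold condition.

    Under the conditions at infinity e x = int_{-oo}^x (rho0 - c) determines the flow itself.
    The threshold condition then says that u0/w - e/c is nondecreasing; as this
    function vanishes at both ends of the line, equality holds everywhere.  Conversely, as
    long as J is positive the explicit flow is invertible and the fields transported by it
    solve the system.  A solution that satisfies the conditions at infinity at some positive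
    time has u0' -> 0, hence J -> 1 at infinity, so the first time at which J vanishes is
    attained on some characteristic: it is the maximal time of existence. *)

(** * Limits, derivatives and integrals *)

(** Following u_x along a characteristic by differentiating the momentum equation would need second
    derivatives of u, and u is only C^1. Comparing two characteristics replaces this: mass
    conservation and Poisson's equation express the difference of the forces through the distance,
    with no further derivative. Differences also suit the lack of decay. Without conditions at
    infinity, E is fixed only up to a function of time and the flow up to a translation depending on
    time; neither affects J, so the bounds along characteristics hold in that generality. The
    construction meets another obstacle: [rho0 / J] contains u0', so a C^1 density requires u0' to
    be C^1, and uniformity in the label requires u0' to vanish at infinity. The data alone give
    neither. In the global case both come from equality in the threshold condition; in the breakdown
    case they are read off from the density of the given solution at one positive time. *)

Section FilterLimits.
Context {T : Type} {F : (T -> Prop) -> Prop} {FF : Filter F}.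

Lemma filterlim_Rplus (f g : T -> R) (a b : R) :
  filterlim f F (locally a) -> filterlim g F (locally b) ->
  filterlim (fun x => f x + g x) F (locally (a + b)).
Proof.
  intros Hf Hg.
  exact (filterlim_comp_2 f g Rplus Hf Hg (filterlim_plus a b)).
Qed.

Lemma filterlim_Rmult (f g : T -> R) (a b : R) :
  filterlim f F (locally a) -> filterlim g F (locally b) ->
  filterlim (fun x => f x * g x) F (locally (a * b)).
Proof.
  intros Hf Hg.
  exact (filterlim_comp_2 f g Rmult Hf Hg (filterlim_mult a b)).
Qed.

Lemma filterlim_Ropp (f : T -> R) (a : R) :
  filterlim f F (locally a) -> filterlim (fun x => - f x) F (locally (- a)).
Proof.
  intros Hf. exact (filterlim_comp _ _ _ _ _ _ _ _ Hf (filterlim_opp a)).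
Qed.

Lemma filterlim_Rminus (f g : T -> R) (a b : R) :
  filterlim f F (locally a) -> filterlim g F (locally b) ->
  filterlim (fun x => f x - g x) F (locally (a - b)).
Proof.
  intros Hf Hg. apply filterlim_Rplus; [|apply filterlim_Ropp]; assumption.
Qed.

Lemma filterlim_comp_continuous (f : T -> R) (g : R -> R) (a : R) :
  filterlim f F (locally a) -> continuous g a ->
  filterlim (fun x => g (f x)) F (locally (g a)).
Proof.
  intros Hf Hg. exact (filterlim_comp _ _ _ _ _ _ _ _ Hf Hg).
Qed.

Lemma filterlim_Rdiv (f g : T -> R) (a b : R) :
  filterlim f F (locally a) -> filterlim g F (locally b) -> b <> 0 ->
  filterlim (fun x => f x / g x) F (locally (a / b)).
Proof.
  intros Hf Hg Hb. apply filterlim_Rmult; [assumption|].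
  apply (filterlim_comp_continuous g Rinv); [assumption|].
  apply continuous_Rinv; assumption.
Qed.

Lemma filterlim_pair (f g : T -> R) (a b : R) :
  filterlim f F (locally a) -> filterlim g F (locally b) ->
  filterlim (fun x => (f x, g x)) F (locally (a, b)).
Proof.
  intros Hf Hg. apply filterlim_locally. intros eps.
  generalize (filter_and _ _ (proj1 (filterlim_locally f a) Hf eps)
                (proj1 (filterlim_locally g b) Hg eps)).
  apply filter_imp. intros x [H1 H2]. split; assumption.
Qed.

End FilterLimits.

(** Lets [limits] compute the limit as a term of its own, to be identified afterwards by [ring] or
    [field]. *)
Lemma filterlim_eq {T} {F : (T -> Prop) -> Prop} {FF : Filter F} (f : T -> R) (a b : R) :
  filterlim f F (locally a) -> a = b -> filterlim f F (locally b).
Proof. intros H <-. exact H. Qed.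

(* Leaves as goals the limits of atoms that are not hypotheses, and the nonvanishing of
   limits of denominators. *)
Ltac limits :=
  cbv beta;
  first
  [ eassumption
  | lazymatch goal with
    | |- filterlim (fun x => x) _ _ => refine (filterlim_id _ _)
    | |- filterlim (fun _ => ?c) _ _ => refine (filterlim_const c)
    | |- filterlim (fun x => @?f x + @?g x) _ _ =>
        refine (filterlim_Rplus f g _ _ _ _); limits
    | |- filterlim (fun x => @?f x - @?g x) _ _ =>
        refine (filterlim_Rminus f g _ _ _ _); limits
    | |- filterlim (fun x => @?f x * @?g x) _ _ =>
        refine (filterlim_Rmult f g _ _ _ _); limits
    | |- filterlim (fun x => - @?f x) _ _ =>
        refine (filterlim_Ropp f _ _); limits
    | |- filterlim (fun x => @?f x / @?g x) _ _ =>
        refine (filterlim_Rdiv f g _ _ _ _ _); limits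
    | _ => idtac
    end ].

Lemma continuous_R_spec (f : R -> R) (x : R) :
  continuous f x <-> forall eps, 0 < eps ->
    exists d, 0 < d /\ forall y, Rabs (y - x) < d -> Rabs (f y - f x) < eps.
Proof.
  split.
  - intros H eps He.
    destruct (proj1 (filterlim_locally f (f x)) H (mkposreal eps He)) as [d Hd].
    exists d. split; [apply cond_pos|]. intros y Hy. exact (Hd y Hy).
  - intros H. apply filterlim_locally. intros eps.
    destruct (H eps (cond_pos eps)) as [d [Hd0 Hd]].
    exists (mkposreal d Hd0). intros y Hy. exact (Hd y Hy).
Qed.

Lemma continuous_Rmax_0 : continuous (Rmax 0) 0.
Proof.
  apply continuous_R_spec. intros eps He. exists eps. split; [exact He|]. intros y Hy.
  rewrite (Rmax_left 0 0), Rminus_0_r in * by lra.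
  apply Rmax_case; [rewrite Rabs_R0; exact He | exact Hy].
Qed.

Lemma is_derive_eq_val (f : R -> R) (x l l' : R) :
  is_derive f x l -> l = l' -> is_derive f x l'.
Proof. intros H <-. exact H. Qed.

Lemma derivable_pt_lim_eq_val (f : R -> R) (x l l' : R) :
  derivable_pt_lim f x l -> l = l' -> derivable_pt_lim f x l'.
Proof. intros H <-. exact H. Qed.

Lemma filterlim_locally_within_open {T : UniformSpace} {U : UniformSpace}
    (f : T -> U) (D : T -> Prop) (p : T) (l : U) :
  locally p D -> filterlim f (within D (locally p)) (locally l) ->
  filterlim f (locally p) (locally l).
Proof.
  intros HD H P HP. specialize (H P HP). unfold filtermap, within in *.
  generalize (filter_and _ _ HD H). apply filter_imp. intros x [H1 H2]. auto.
Qed.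

(* The eta-expanded form produced by [auto_derive]. *)
Lemma Derive_eta (f : R -> R) (x l : R) :
  is_derive f x l -> Derive (fun y : R => f y) x = l.
Proof. apply is_derive_unique. Qed.

(** The equations hold for t > 0 only, so the initial datum enters as a right limit rather than as a
    value at 0. *)
Lemma is_derive_const_on_right (T : Rbar) (f : R -> R) (l : R) :
  (forall t, 0 < t -> Rbar_lt t T -> is_derive f t 0) ->
  filterlim f (at_right 0) (locally l) ->
  forall t, 0 < t -> Rbar_lt t T -> f t = l.
Proof.
  intros Hd Hl t Ht HtT.
  apply (filterlim_locally_unique (F := at_right 0) f); [|exact Hl].
  apply (filterlim_ext_loc (fun _ => f t)); [|apply filterlim_const].
  exists (mkposreal t Ht). intros s Hs Hs0.
  assert (Hst : s < t).
  { unfold ball in Hs; simpl in Hs; unfold AbsRing_ball, abs, minus, plus, opp in Hs;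
      simpl in Hs.
    apply Rabs_def2 in Hs. lra. }
  destruct (MVT_gen f s t (fun _ => 0)) as [x [_ Hx]].
  - intros x Hx. rewrite Rmin_left, Rmax_right in Hx by lra. apply Hd; [lra|].
    apply Rbar_lt_trans with t; [simpl; lra | exact HtT].
  - intros x Hx. rewrite Rmin_left, Rmax_right in Hx by lra.
    apply continuity_pt_filterlim. apply (@ex_derive_continuous R_AbsRing R_NormedModule).
    exists 0. apply Hd; [lra|].
    apply Rbar_le_lt_trans with t; [simpl; lra | exact HtT].
  - lra.
Qed.

(* Both exponentials [exp (-+ w t) * (g t +- w f t)] are constant. *)
Lemma hyperbolic_ode_zero (T : Rbar) (w : R) (f g : R -> R) :
  0 < w ->
  (forall t, 0 < t -> Rbar_lt t T -> is_derive f t (g t)) ->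
  (forall t, 0 < t -> Rbar_lt t T -> is_derive g t (w * w * f t)) ->
  filterlim f (at_right 0) (locally 0) ->
  filterlim g (at_right 0) (locally 0) ->
  forall t, 0 < t -> Rbar_lt t T -> f t = 0 /\ g t = 0.
Proof.
  intros Hw Hf Hg Lf Lg t Ht HtT.
  assert (Hexp : forall a, filterlim (fun t => exp (a * t)) (at_right 0) (locally (exp (a * 0)))).
  { intros a. apply (filterlim_filter_le_1 (F := locally 0)).
    - apply filter_le_within.
    - apply (ex_derive_continuous (fun t => exp (a * t))). auto_derive; trivial. }
  assert (H : forall a, a = w \/ a = - w -> exp (- a * t) * (g t + a * f t) = 0).
  { intros a Ha.
    apply (is_derive_const_on_right T (fun t => exp (- a * t) * (g t + a * f t)) 0);
      try assumption.
    - intros s Hs HsT. specialize (Hf s Hs HsT). specialize (Hg s Hs HsT).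
      auto_derive.
      + repeat split; trivial; eexists; eassumption.
      + rewrite (Derive_eta _ _ _ Hg), (Derive_eta _ _ _ Hf).
        destruct Ha as [-> | ->]; ring.
    - eapply filterlim_eq.
      + limits. apply Hexp.
      + ring. }
  assert (H1 := H w (or_introl eq_refl)). assert (H2 := H (- w) (or_intror eq_refl)).
  apply Rmult_integral in H1. apply Rmult_integral in H2.
  assert (P1 := exp_pos (- w * t)). assert (P2 := exp_pos (- - w * t)).
  assert (E1 : g t + w * f t = 0) by lra. assert (E2 : g t - w * f t = 0) by lra.
  split; [|lra]. apply Rmult_eq_reg_l with w; lra.
Qed.

(* Along the level set, |lx| |g s - g s0| <= (error) + |ly| |s - s0|, where the error is
   absorbed; this gives a Lipschitz bound for g, which makes the error o(|s - s0|). *)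
Lemma is_derive_implicit (F : R -> R -> R) (g : R -> R) (s0 lx ly : R) :
  differentiable_pt_lim F (g s0) s0 lx ly -> lx <> 0 -> continuous g s0 ->
  locally s0 (fun s => F (g s) s = F (g s0) s0) ->
  is_derive g s0 (- ly / lx).
Proof.
  intros HF Hlx Hg Hlev.
  apply is_derive_Reals. intros eps Heps.
  assert (Hax : 0 < Rabs lx) by (apply Rabs_pos_lt; assumption).
  set (K := 1 + 2 * (Rabs ly + Rabs lx) / Rabs lx).
  assert (HK : 1 <= K).
  { unfold K. assert (0 <= 2 * (Rabs ly + Rabs lx) / Rabs lx); [|lra].
    apply Rdiv_le_0_compat; [|lra]. pose proof (Rabs_pos ly). lra. }
  (* The first bound lets the error be absorbed by [Rabs lx * Rabs D]; the second leaves only half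
     of [eps] once [K] bounds the difference quotient. *)
  set (e1 := Rmin (Rabs lx / 2) (eps * Rabs lx / (2 * K))).
  assert (He1 : 0 < e1).
  { apply Rmin_glb_lt; [lra|]. apply Rdiv_lt_0_compat; nra. }
  destruct (HF (mkposreal e1 He1)) as [d1 Hd1].
  destruct (proj1 (continuous_R_spec g s0) Hg d1 (cond_pos d1)) as [d2 [Hd2 Hcont]].
  destruct Hlev as [d3 Hd3].
  assert (Hd : 0 < Rmin d1 (Rmin d2 d3)).
  { repeat apply Rmin_glb_lt; try apply cond_pos; assumption. }
  exists (mkposreal _ Hd). intros h Hh0 Hh. simpl in Hh.
  assert (Hh1 : Rabs h < d1) by (eapply Rlt_le_trans; [exact Hh | apply Rmin_l]).
  assert (Hh2 : Rabs h < d2).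
  { eapply Rlt_le_trans; [exact Hh|]. eapply Rle_trans; [apply Rmin_r | apply Rmin_l]. }
  assert (Hh3 : Rabs h < d3).
  { eapply Rlt_le_trans; [exact Hh|]. eapply Rle_trans; [apply Rmin_r | apply Rmin_r]. }
  assert (Esh : s0 + h - s0 = h) by ring.
  assert (HL : F (g (s0 + h)) (s0 + h) = F (g s0) s0).
  { apply Hd3. unfold ball; simpl; unfold AbsRing_ball, abs, minus, plus, opp; simpl.
    replace (s0 + h + - s0) with h by ring. exact Hh3. }
  assert (HC : Rabs (g (s0 + h) - g s0) < d1) by (apply Hcont; rewrite Esh; exact Hh2).
  assert (HD := Hd1 (g (s0 + h)) (s0 + h) HC ltac:(rewrite Esh; exact Hh1)).
  simpl in HD. rewrite HL, Esh in HD.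
  set (D := g (s0 + h) - g s0) in *.
  replace (F (g s0) s0 - F (g s0) s0 - (lx * D + ly * h)) with (- (lx * D + ly * h)) in HD by ring.
  rewrite Rabs_Ropp in HD.
  assert (Hmax : Rmax (Rabs D) (Rabs h) <= Rabs D + Rabs h).
  { apply Rmax_lub; pose proof (Rabs_pos D); pose proof (Rabs_pos h); lra. }
  assert (Hah : 0 < Rabs h) by (apply Rabs_pos_lt; assumption).
  assert (HlD : Rabs lx * Rabs D <= Rabs (lx * D + ly * h) + Rabs ly * Rabs h).
  { rewrite <- !Rabs_mult. replace (lx * D) with ((lx * D + ly * h) - ly * h) at 1 by ring.
    unfold Rminus. eapply Rle_trans; [apply Rabs_triang|]. rewrite Rabs_Ropp. lra. }
  assert (HDh : Rabs D <= K * Rabs h).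
  { assert (H1 : e1 <= Rabs lx / 2) by apply Rmin_l.
    assert (H2 : e1 * Rmax (Rabs D) (Rabs h) <= Rabs lx / 2 * (Rabs D + Rabs h)).
    { apply Rmult_le_compat; try lra.
      eapply Rle_trans; [apply Rabs_pos | apply Rmax_l]. }
    assert (H3 : Rabs lx * Rabs D <= (2 * Rabs ly + Rabs lx) * Rabs h) by nra.
    apply Rmult_le_reg_l with (Rabs lx); [assumption|].
    eapply Rle_trans; [exact H3|]. unfold K.
    replace (Rabs lx * ((1 + 2 * (Rabs ly + Rabs lx) / Rabs lx) * Rabs h)) with
      ((Rabs lx + 2 * (Rabs ly + Rabs lx)) * Rabs h) by (field; lra).
    pose proof (Rabs_pos ly). nra. }
  assert (Hfin : Rabs (lx * D + ly * h) <= eps * Rabs lx / 2 * Rabs h).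
  { eapply Rle_trans; [exact HD|].
    assert (H1 : e1 <= eps * Rabs lx / (2 * K)) by apply Rmin_r.
    assert (H2 : Rmax (Rabs D) (Rabs h) <= K * Rabs h).
    { apply Rmax_lub; [assumption | nra]. }
    replace (eps * Rabs lx / 2 * Rabs h) with (eps * Rabs lx / (2 * K) * (K * Rabs h)) by (field; lra).
    apply Rmult_le_compat; try lra.
    eapply Rle_trans; [apply Rabs_pos | apply Rmax_l]. }
  fold D.
  replace (D / h - - ly / lx) with ((lx * D + ly * h) / (lx * h)) by (field; auto).
  unfold Rdiv. rewrite Rabs_mult, Rabs_inv, Rabs_mult.
  apply Rmult_lt_reg_r with (Rabs lx * Rabs h); [nra|].
  rewrite Rmult_assoc, Rinv_l by nra.
  assert (0 < eps * Rabs lx * Rabs h) by (repeat apply Rmult_lt_0_compat; lra). nra.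
Qed.

(** Arbitrary filters at both ends cover the integral over the line as well as the one ending at
    [at_point x]. *)
Lemma is_RInt_gen_antiderivative (f e : R -> R) (Fa Fb : (R -> Prop) -> Prop)
    {FFa : Filter Fa} {FFb : Filter Fb} (la lb : R) :
  (forall x, is_derive e x (f x)) -> (forall x, continuous f x) ->
  filterlim e Fa (locally la) -> filterlim e Fb (locally lb) ->
  is_RInt_gen f Fa Fb (lb - la).
Proof.
  intros He Hf Ha Hb.
  assert (E : forall x, Derive e x = f x) by (intros x; apply is_derive_unique, He).
  apply (is_RInt_gen_ext (Derive e)).
  - apply filter_forall. intros ab x _. apply E.
  - apply is_RInt_gen_Derive; try assumption; apply filter_forall; intros ab x _.
    + exists (f x). apply He.
    + apply continuous_ext with f; [intros; symmetry; apply E | apply Hf].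
Qed.

(** The improper integral controls [P b - P a] only jointly in both ends. Holding one end fixed
    shows that [P] is Cauchy at the other, so both limits exist separately, and subtracting the one
    at [m_infty] normalizes [P]. *)
Lemma is_RInt_gen_line_antiderivative (f : R -> R) (l : R) :
  (forall x, continuous f x) ->
  is_RInt_gen f (Rbar_locally m_infty) (Rbar_locally p_infty) l ->
  exists e : R -> R, (forall x, is_derive e x (f x)) /\
    is_lim e m_infty 0 /\ is_lim e p_infty l.
Proof.
  intros Hf HI. set (P := RInt f 0).
  assert (HP : forall x, is_derive P x (f x)).
  { intros x. apply (is_derive_RInt f P 0 x); [|apply Hf].
    apply filter_forall. intros b. apply (RInt_correct (V := R_CompleteNormedModule)).
    apply (ex_RInt_continuous (V := R_CompleteNormedModule)). auto. }
  assert (Hclose : forall eps : posreal, exists Qa Qb,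
    Rbar_locally m_infty Qa /\ Rbar_locally p_infty Qb /\
    forall a b, Qa a -> Qb b -> Rabs (P b - P a - l) < eps).
  { intros eps. destruct (proj1 (filterlimi_locally _ _) HI eps) as [Qa Qb HQa HQb HQ].
    exists Qa, Qb. split; [exact HQa|]. split; [exact HQb|]. intros a b Ha Hb.
    destruct (HQ a b Ha Hb) as [z [Hz Hball]].
    replace (P b - P a) with z; [exact Hball|].
    simpl in Hz. rewrite <- (is_RInt_unique _ _ _ _ Hz).
    apply (is_RInt_unique (V := R_CompleteNormedModule) f a b (P b - P a)).
    apply (is_RInt_derive (V := R_CompleteNormedModule) P f); auto. }
  assert (Hm : exists lm : R, is_lim P m_infty lm).
  { apply (proj1 (filterlim_locally_cauchy (F := Rbar_locally m_infty) P)). intros eps.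
    destruct (Hclose (pos_div_2 eps)) as (Qa & Qb & HQa & HQb & HQ).
    destruct (filter_ex (F := Rbar_locally p_infty) _ HQb) as [b Hb].
    exists Qa. split; [exact HQa|]. intros u v Hu Hv.
    assert (H1 := HQ u b Hu Hb). assert (H2 := HQ v b Hv Hb). simpl in H1, H2.
    apply Rabs_def2 in H1. apply Rabs_def2 in H2. apply Rabs_def1;
      unfold minus, plus, opp; simpl; lra. }
  assert (Hp : exists lp : R, is_lim P p_infty lp).
  { apply (proj1 (filterlim_locally_cauchy (F := Rbar_locally p_infty) P)). intros eps.
    destruct (Hclose (pos_div_2 eps)) as (Qa & Qb & HQa & HQb & HQ).
    destruct (filter_ex (F := Rbar_locally m_infty) _ HQa) as [a Ha].
    exists Qb. split; [exact HQb|]. intros u v Hu Hv.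
    assert (H1 := HQ a u Ha Hu). assert (H2 := HQ a v Ha Hv). simpl in H1, H2.
    apply Rabs_def2 in H1. apply Rabs_def2 in H2. apply Rabs_def1;
      unfold minus, plus, opp; simpl; lra. }
  destruct Hm as [lm Hm]. destruct Hp as [lp Hp].
  assert (El : lp - lm = l).
  { rewrite <- (is_RInt_gen_unique (V := R_CompleteNormedModule) _ _ HI). symmetry.
    apply (is_RInt_gen_unique (V := R_CompleteNormedModule) f).
    apply is_RInt_gen_antiderivative with P; auto; typeclasses eauto. }
  exists (fun x => P x - lm). split; [|split].
  - intros x. auto_derive.
    + exists (f x). apply HP.
    + rewrite (Derive_eta P x (f x)); [ring | apply HP].
  - eapply filterlim_eq; [limits; exact Hm | ring].
  - eapply filterlim_eq; [limits; exact Hp | exact El].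
Qed.

Lemma continuous_RInt_param (f : R -> R -> R) (a b t0 : R) :
  a <= b ->
  (forall s, a <= s <= b -> continuity_2d_pt f s t0) ->
  locally t0 (fun t => ex_RInt (fun s => f s t) a b) ->
  continuous (fun t => RInt (fun s => f s t) a b) t0.
Proof.
  intros Hab Hf Hex. apply filterlim_locally. intros eps.
  (* The [+ 1] keeps the denominator positive when a = b and makes the final estimate strict. *)
  assert (He : 0 < eps / (b - a + 1)) by (apply Rdiv_lt_0_compat; [apply cond_pos | lra]).
  destruct (uniform_continuity_2d_1d f a b t0 Hf (mkposreal _ He)) as [d Hd].
  assert (Hball : locally t0 (fun t => ball t0 d t)) by (apply locally_ball).
  generalize (filter_and _ _ Hex Hball). apply filter_imp. intros t [Ht Htd].
  unfold ball in *; simpl in *; unfold AbsRing_ball, abs, minus, plus, opp in *; simpl in *.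
  apply Rabs_def2 in Htd.
  assert (Hex0 := locally_singleton _ _ Hex).
  change (RInt (fun s => f s t) a b + - RInt (fun s => f s t0) a b)
    with (minus (RInt (fun s => f s t) a b) (RInt (fun s => f s t0) a b)).
  rewrite <- RInt_minus by assumption.
  apply Rle_lt_trans with ((b - a) * (eps / (b - a + 1))).
  - apply abs_RInt_le_const; [assumption | |].
    + apply (ex_RInt_minus (fun s => f s t) (fun s => f s t0)); assumption.
    + intros s Hs. left. apply Hd; try lra. rewrite Rminus_diag, Rabs_R0. apply cond_pos.
  - assert (Hc := cond_pos eps).
    apply Rmult_lt_reg_r with (b - a + 1); [lra|].
    replace ((b - a) * (eps / (b - a + 1)) * (b - a + 1)) with ((b - a) * eps) by (field; lra).
    lra.
Qed.

Lemma bounded_of_is_lim (f : R -> R) (lm lp : R) :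
  (forall x, continuous f x) -> is_lim f m_infty lm -> is_lim f p_infty lp ->
  exists M, forall x, Rabs (f x) <= M.
Proof.
  intros Hf Hm Hp.
  destruct (proj1 (filterlim_locally f lm) Hm (mkposreal 1 Rlt_0_1)) as [m Hm'].
  destruct (proj1 (filterlim_locally f lp) Hp (mkposreal 1 Rlt_0_1)) as [p Hp'].
  set (a := Rmin m p - 1). set (b := Rmax m p + 1).
  assert (Hab : a <= b).
  { unfold a, b. pose proof (Rmin_l m p). pose proof (Rmax_l m p). lra. }
  destruct (continuity_ab_maj (fun x => Rabs (f x)) a b Hab) as [x0 [Hx0 _]].
  { intros x _. apply continuity_pt_filterlim.
    apply (filterlim_comp_continuous f Rabs); [apply Hf | apply continuous_Rabs]. }
  exists (Rmax (Rabs (f x0)) (Rmax (Rabs lm + 1) (Rabs lp + 1))). intros x.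
  assert (Htri : forall l, Rabs (f x - l) < 1 -> Rabs (f x) <= Rabs l + 1).
  { intros l Hl. replace (f x) with ((f x - l) + l) by ring.
    eapply Rle_trans; [apply Rabs_triang | lra]. }
  destruct (Rlt_le_dec x a) as [Hxa | Hxa].
  - eapply Rle_trans; [|apply Rmax_r]. eapply Rle_trans; [|apply Rmax_l].
    apply Htri, Hm'. unfold a in Hxa. pose proof (Rmin_l m p). lra.
  - destruct (Rlt_le_dec b x) as [Hxb | Hxb].
    + eapply Rle_trans; [|apply Rmax_r]. eapply Rle_trans; [|apply Rmax_r].
      apply Htri, Hp'. unfold b in Hxb. pose proof (Rmax_r m p). lra.
    + eapply Rle_trans; [|apply Rmax_l]. apply Hx0. lra.
Qed.

Lemma C1_line_intro (f f' : R -> R) :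
  (forall x, is_derive f x (f' x)) -> (forall x, continuous f' x) -> C1_line f.
Proof.
  intros Hd Hc x. split; [exists (f' x); apply Hd|].
  apply continuous_ext with f'; [|apply Hc].
  intros y. symmetry. apply is_derive_unique, Hd.
Qed.

Lemma C1_line_is_derive (f : R -> R) (x : R) : C1_line f -> is_derive f x (Derive f x).
Proof. intros H. apply Derive_correct, H. Qed.

Lemma C1_line_continuous (f : R -> R) (x : R) : C1_line f -> continuous f x.
Proof. intros H. apply (@ex_derive_continuous R_AbsRing R_NormedModule), H. Qed.

(** * The explicit flow *)

Section ScalarJacobian.
Context (w p d : R) (hw : 0 < w).

(* The Jacobian of the flow along one characteristic, with p = rho0 / c and d = u0'. *)
Definition jacobian (t : R) : R :=
  p + (1 - p) * cosh (w * t) + d / w * sinh (w * t).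

Definition jacobian_dt (t : R) : R :=
  (1 - p) * (w * sinh (w * t)) + d * cosh (w * t).

Lemma cosh_eq_exp (x : R) : cosh x = (exp x + exp (- x)) / 2.
Proof. reflexivity. Qed.

Lemma sinh_eq_exp (x : R) : sinh x = (exp x - exp (- x)) / 2.
Proof. reflexivity. Qed.

Lemma is_derive_cosh_scal (t : R) : is_derive (fun s => cosh (w * s)) t (w * sinh (w * t)).
Proof. unfold cosh, sinh. auto_derive; trivial. field. Qed.

Lemma is_derive_sinh_scal (t : R) : is_derive (fun s => sinh (w * s)) t (w * cosh (w * t)).
Proof. unfold cosh, sinh. auto_derive; trivial. field. Qed.

Lemma is_derive_jacobian (t : R) : is_derive jacobian t (jacobian_dt t).
Proof.
  unfold jacobian, jacobian_dt, cosh, sinh. auto_derive; trivial. field. lra.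
Qed.

Lemma continuity_jacobian : continuity jacobian.
Proof.
  intros t. apply continuity_pt_filterlim.
  apply (@ex_derive_continuous R_AbsRing R_NormedModule).
  exists (jacobian_dt t). apply is_derive_jacobian.
Qed.

Lemma jacobian_0 : jacobian 0 = 1.
Proof. unfold jacobian. rewrite Rmult_0_r, cosh_0, sinh_0. ring. Qed.

(* The growing mode has amplitude half of [d / w + (1 - p)], which is the quantity
   whose sign the threshold condition decides. *)
Lemma jacobian_modes (t : R) :
  jacobian t = p * (1 - exp (- (w * t))) + exp (- (w * t))
               + (d / w + (1 - p)) * sinh (w * t).
Proof. unfold jacobian. rewrite cosh_eq_exp, sinh_eq_exp. field. lra. Qed.

Lemma jacobian_dt_modes (t : R) :
  jacobian_dt t = w * ((d / w + (1 - p)) * cosh (w * t) - (1 - p) * exp (- (w * t))).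
Proof. unfold jacobian_dt. rewrite cosh_eq_exp, sinh_eq_exp. field. lra. Qed.

Lemma exp_neg_scal_bounds (t : R) : 0 <= t -> 0 < exp (- (w * t)) <= 1.
Proof.
  intros Ht. split; [apply exp_pos|]. rewrite <- exp_0.
  destruct (Rle_lt_or_eq_dec 0 t Ht) as [H | <-].
  - left. apply exp_increasing. nra.
  - right. f_equal. ring.
Qed.

Lemma sinh_scal_nonneg (t : R) : 0 <= t -> 0 <= sinh (w * t).
Proof.
  intros Ht. rewrite sinh_eq_exp.
  assert (H := exp_neg_scal_bounds t Ht).
  assert (H2 : exp (w * t) * exp (- (w * t)) = 1).
  { rewrite <- exp_plus, Rplus_opp_r. apply exp_0. }
  nra.
Qed.

(** The bounded part of [jacobian_modes] is a convex combination of p and 1 with weight e^{-wt},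
    hence at least [Rmin p 1]. *)
Lemma jacobian_lower_bound (t : R) :
  0 < p -> 0 <= d / w + (1 - p) -> 0 <= t ->
  Rmin p 1 + (d / w + (1 - p)) * sinh (w * t) <= jacobian t.
Proof.
  intros Hp Hd Ht. rewrite jacobian_modes.
  assert (H := exp_neg_scal_bounds t Ht).
  assert (Hm : Rmin p 1 <= p) by apply Rmin_l. assert (Hm1 : Rmin p 1 <= 1) by apply Rmin_r.
  nra.
Qed.

Lemma jacobian_positive (t : R) :
  0 < p -> 0 <= d / w + (1 - p) -> 0 <= t -> 0 < jacobian t.
Proof.
  intros Hp Hd Ht. eapply Rlt_le_trans; [|apply jacobian_lower_bound; assumption].
  assert (Hs := sinh_scal_nonneg t Ht).
  assert (0 < Rmin p 1) by (apply Rmin_glb_lt; lra). nra.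
Qed.

(** With y = e^{-wt} and D = d/w + 1 - p, dropping p (1 - y) leaves e^{wt} (y^2 + (D/2) (1 - y^2)),
    where the bracket is a convex combination of 1 and D/2. *)
Lemma jacobian_exp_growth (t : R) :
  0 < p -> 0 < d / w + (1 - p) -> 0 <= t ->
  Rmin 1 ((d / w + (1 - p)) / 2) * exp (w * t) <= jacobian t.
Proof.
  intros Hp Hd Ht. rewrite jacobian_modes, sinh_eq_exp.
  assert (H := exp_neg_scal_bounds t Ht).
  assert (H2 : exp (w * t) * exp (- (w * t)) = 1).
  { rewrite <- exp_plus, Rplus_opp_r. apply exp_0. }
  set (D := d / w + (1 - p)) in *. set (y := exp (- (w * t))) in *.
  set (z := exp (w * t)) in *.
  assert (Hm : Rmin 1 (D / 2) <= D / 2) by apply Rmin_r.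
  assert (Hm1 : Rmin 1 (D / 2) <= 1) by apply Rmin_l.
  set (m := Rmin 1 (D / 2)) in *.
  assert (Hy2 : z * (y * y) = y) by nra.
  assert (Hz : 0 < z) by apply exp_pos.
  assert (Hyy : 0 <= y * y <= 1) by nra.
  assert (H3 : m <= y * y + D / 2 * (1 - y * y)).
  { assert (0 <= (D / 2 - m) * (1 - y * y)) by (apply Rmult_le_pos; lra).
    assert (0 <= (1 - m) * (y * y)) by (apply Rmult_le_pos; lra). lra. }
  apply Rle_trans with (z * (y * y + D / 2 * (1 - y * y))); [nra|].
  replace (z * (y * y + D / 2 * (1 - y * y))) with (z * (y * y) + D / 2 * (z - z * (y * y))) by ring.
  rewrite Hy2. nra.
Qed.

(** Since cosh = sinh + e^{-wt}, the growing parts of J and J_t / w are the same D sinh (w t). The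
    remainder of J_t / w is at most |1 - p| + D, which is compared with the lower bound [Rmin p 1]
    of the rest of J. *)
Lemma jacobian_dt_le_jacobian (t : R) :
  0 < p -> 0 <= d / w + (1 - p) -> 0 <= t ->
  Rabs (jacobian_dt t) <=
    w * (1 + (Rabs (1 - p) + (d / w + (1 - p))) / Rmin p 1) * jacobian t.
Proof.
  intros Hp Hd Ht. assert (Hl := jacobian_lower_bound t Hp Hd Ht).
  rewrite jacobian_dt_modes. set (D := d / w + (1 - p)) in *.
  assert (H := exp_neg_scal_bounds t Ht). assert (Hs := sinh_scal_nonneg t Ht).
  assert (Hc : cosh (w * t) = sinh (w * t) + exp (- (w * t))).
  { rewrite cosh_eq_exp, sinh_eq_exp. field. }
  rewrite Hc, Rabs_mult, (Rabs_pos_eq w), Rmult_assoc by lra.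
  apply Rmult_le_compat_l; [lra|].
  assert (Hm : 0 < Rmin p 1) by (apply Rmin_glb_lt; lra).
  set (m := Rmin p 1) in *. set (S := sinh (w * t)) in *. set (y := exp (- (w * t))) in *.
  apply Rle_trans with (D * S + (Rabs (1 - p) + D)).
  - replace (D * (S + y) - (1 - p) * y) with (D * S + (D * y + - ((1 - p) * y))) by ring.
    eapply Rle_trans; [apply Rabs_triang|]. rewrite (Rabs_pos_eq (D * S)) by nra.
    apply Rplus_le_compat_l.
    eapply Rle_trans; [apply Rabs_triang|]. rewrite Rabs_Ropp, (Rabs_mult (1 - p)).
    rewrite (Rabs_pos_eq (D * y)), (Rabs_pos_eq y) by nra.
    pose proof (Rabs_pos (1 - p)). nra.
  - assert (Hq : 0 <= (Rabs (1 - p) + D) / m).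
    { apply Rdiv_le_0_compat; [|assumption]. pose proof (Rabs_pos (1 - p)). lra. }
    set (q := (Rabs (1 - p) + D) / m) in *.
    replace (Rabs (1 - p) + D) with (q * m) by (unfold q; field; lra).
    assert (0 <= D * S) by nra. nra.
Qed.

Lemma jacobian_reaches_0 :
  0 < p -> d / w + (1 - p) < 0 -> exists t, 0 <= t /\ jacobian t <= 0.
Proof.
  intros Hp Hd. set (D := d / w + (1 - p)) in *.
  (* From e^z > 1 + z follows sinh z >= z/2, and z is chosen so that D z / 2 = - (p + 1), which
     outweighs the bounded part p (1 - y) + y of the Jacobian. *)
  set (z := 2 * (p + 1) / - D).
  assert (Hz : 0 < z) by (apply Rdiv_lt_0_compat; lra).
  exists (z / w).
  assert (Ht : 0 <= z / w) by (left; apply Rdiv_lt_0_compat; lra). split; [exact Ht|].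
  rewrite jacobian_modes. fold D.
  assert (H := exp_neg_scal_bounds _ Ht).
  assert (Hs : z / 2 <= sinh (w * (z / w))).
  { rewrite sinh_eq_exp. replace (w * (z / w)) with z in * by (field; lra).
    assert (1 + z < exp z) by (apply exp_ineq1; lra). lra. }
  assert (HDz : D * z = - (2 * (p + 1))) by (unfold z; field; lra).
  assert (D * sinh (w * (z / w)) <= D * (z / 2)) by nra. nra.
Qed.

End ScalarJacobian.

Section Flow.
Context (w c : R) (rho0 u0 e : R -> R).

Definition flow_jac (a t : R) : R := jacobian w (rho0 a / c) (Derive u0 a) t.
Definition flow_jac_dt (a t : R) : R := jacobian_dt w (rho0 a / c) (Derive u0 a) t.

(** Under decay at infinity the mass flux gives E' = - c u along characteristics. With k = - w^2 /
    c, the functions [flow_map], [flow_velocity] and [flow_force] solve the linear system x' = u, u'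
    = k E, E' = - c u with data a, [u0 a], [e a]. *)
Definition flow_map (a t : R) : R :=
  a + u0 a / w * sinh (w * t) - e a / c * (cosh (w * t) - 1).
Definition flow_velocity (a t : R) : R :=
  u0 a * cosh (w * t) - w / c * e a * sinh (w * t).
Definition flow_force (a t : R) : R :=
  e a * cosh (w * t) - c / w * u0 a * sinh (w * t).

Context (hw : 0 < w) (hc : 0 < c).

Lemma is_derive_flow_dt (a t : R) : is_derive (flow_map a) t (flow_velocity a t).
Proof. unfold flow_map, flow_velocity, cosh, sinh. auto_derive; trivial. field. lra. Qed.

Lemma is_derive_velocity_dt (a t : R) :
  is_derive (flow_velocity a) t (- (w * w) / c * flow_force a t).
Proof. unfold flow_velocity, flow_force, cosh, sinh. auto_derive; trivial. field. lra. Qed.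

Lemma flow_0 (a : R) : flow_map a 0 = a.
Proof. unfold flow_map. rewrite Rmult_0_r, cosh_0, sinh_0. ring. Qed.

Lemma velocity_0 (a : R) : flow_velocity a 0 = u0 a.
Proof. unfold flow_velocity. rewrite Rmult_0_r, cosh_0, sinh_0. ring. Qed.

Context (hu0 : C1_line u0) (he : forall x, is_derive e x (rho0 x - c)).

Lemma is_derive_flow_da (a t : R) : is_derive (fun b => flow_map b t) a (flow_jac a t).
Proof.
  unfold flow_map, flow_jac, jacobian. assert (H1 := C1_line_is_derive u0 a hu0). assert (H2 := he a).
  auto_derive.
  - repeat split; trivial; eexists; eassumption.
  - rewrite (Derive_eta _ _ _ H1), (Derive_eta _ _ _ H2). field. lra.
Qed.

Lemma is_derive_velocity_da (a t : R) : is_derive (fun b => flow_velocity b t) a (flow_jac_dt a t).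
Proof.
  unfold flow_velocity, flow_jac_dt, jacobian_dt. assert (H1 := C1_line_is_derive u0 a hu0).
  assert (H2 := he a). auto_derive.
  - repeat split; trivial; eexists; eassumption.
  - rewrite (Derive_eta _ _ _ H1), (Derive_eta _ _ _ H2). field. lra.
Qed.

(** This is Poisson's equation in Lagrangian form: (rho - c) J with rho J = rho0. *)
Lemma is_derive_force_da (a t : R) :
  is_derive (fun b => flow_force b t) a (rho0 a - c * flow_jac a t).
Proof.
  unfold flow_force, flow_jac, jacobian. assert (H1 := C1_line_is_derive u0 a hu0). assert (H2 := he a).
  auto_derive.
  - repeat split; trivial; eexists; eassumption.
  - rewrite (Derive_eta _ _ _ H1), (Derive_eta _ _ _ H2). field. lra.
Qed.

Context {F : (R -> Prop) -> Prop} {FF : Filter F}.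

Lemma filterlim_velocity (t : R) :
  filterlim u0 F (locally 0) -> filterlim e F (locally 0) ->
  filterlim (fun a => flow_velocity a t) F (locally 0).
Proof.
  intros Hu He. unfold flow_velocity. eapply filterlim_eq; [limits | ring].
Qed.

Lemma filterlim_force (t : R) :
  filterlim u0 F (locally 0) -> filterlim e F (locally 0) ->
  filterlim (fun a => flow_force a t) F (locally 0).
Proof.
  intros Hu He. unfold flow_force. eapply filterlim_eq; [limits | ring].
Qed.

(** A flow asymptotic to the identity at both ends maps onto the line, by the intermediate value
    theorem. *)
Lemma filterlim_flow_minus_id (t : R) :
  filterlim u0 F (locally 0) -> filterlim e F (locally 0) ->
  filterlim (fun a => flow_map a t - a) F (locally 0).
Proof.
  intros Hu He.
  apply (filterlim_ext (fun a => u0 a * (sinh (w * t) / w) - e a * ((cosh (w * t) - 1) / c))).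
  - intros a. unfold flow_map. field. lra.
  - eapply filterlim_eq; [limits | ring].
Qed.

End Flow.

Lemma is_lim_infty_of_minus_id (f : R -> R) (l : R) :
  filterlim (fun a => f a - a) (Rbar_locally p_infty) (locally l) -> is_lim f p_infty p_infty.
Proof.
  intros H. apply (is_lim_ext (fun a => (f a - a) + a)); [intros; ring|].
  apply (is_lim_plus _ _ p_infty l p_infty); [exact H | apply is_lim_id | reflexivity].
Qed.

Lemma is_lim_minfty_of_minus_id (f : R -> R) (l : R) :
  filterlim (fun a => f a - a) (Rbar_locally m_infty) (locally l) -> is_lim f m_infty m_infty.
Proof.
  intros H. apply (is_lim_ext (fun a => (f a - a) + a)); [intros; ring|].
  apply (is_lim_plus _ _ m_infty l m_infty); [exact H | apply is_lim_id | reflexivity].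
Qed.

(** * Solutions along characteristics *)

Lemma Rbar_lt_locally_pos (T : Rbar) (t : R) :
  0 < t -> Rbar_lt t T -> locally t (fun s => 0 < s /\ Rbar_lt s T).
Proof.
  intros Ht HtT. apply filter_and; [apply open_gt, Ht | apply open_Rbar_lt, HtT].
Qed.

Section Strip.
Context (T : Rbar) (f : R -> R -> R).

(** The sign condition on [h] keeps the curve in the half plane on which continuity at t = 0 is
    one-sided. *)
Lemma continuous_strip_filterlim (hf : continuous_strip T f) {A} {F : (A -> Prop) -> Prop}
    {FF : Filter F} (g h : A -> R) (x t : R) :
  0 <= t -> Rbar_lt t T ->
  filterlim g F (locally x) -> filterlim h F (locally t) -> F (fun a => 0 <= h a) ->
  filterlim (fun a => f (g a) (h a)) F (locally (f x t)).
Proof.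
  intros Ht HtT Hg Hh Hpos.
  apply (filterlim_comp _ _ _ (fun a => (g a, h a)) (fun p => f (fst p) (snd p)) F
           (within (fun p => 0 <= snd p) (locally (x, t)))); [|apply hf; assumption].
  intros P HP. unfold filtermap, within in *.
  assert (HQ : F (fun a => 0 <= h a -> P (g a, h a)))
    by exact (filterlim_pair g h x t Hg Hh (fun p => 0 <= snd p -> P p) HP).
  generalize (filter_and _ _ Hpos HQ). apply filter_imp.
  intros a Ha. exact (proj2 Ha (proj1 Ha)).
Qed.

Lemma continuous_strip_slice (hf : continuous_strip T f) (x t : R) :
  0 <= t -> Rbar_lt t T -> continuous (fun y => f y t) x.
Proof.
  intros Ht HtT. apply (continuous_strip_filterlim hf (fun y => y) (fun _ => t)); try assumption.
  - apply filterlim_id.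
  - apply filterlim_const.
  - apply filter_forall. intros _. exact Ht.
Qed.

Lemma filterlim_strip_interior (g : R * R -> R) (t x : R) (l : R) :
  0 < t ->
  filterlim g (within (fun p : R * R => 0 <= snd p) (locally (x, t))) (locally l) ->
  filterlim g (locally (x, t)) (locally l).
Proof.
  intros Ht. apply filterlim_locally_within_open.
  exists (mkposreal t Ht). intros [y s] [_ Hs]. simpl in *.
  unfold ball in Hs; simpl in Hs; unfold AbsRing_ball, abs, minus, plus, opp in Hs; simpl in Hs.
  apply Rabs_def2 in Hs. lra.
Qed.

Lemma C1_strip_differentiable (hf : C1_strip T f) (x t : R) :
  0 < t -> Rbar_lt t T -> differentiable_pt_lim f x t (dx f x t) (dt f x t).
Proof.
  intros Ht HtT. apply filterdiff_differentiable_pt_lim.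
  apply (is_derive_filterdiff f x t (dx f) (dt f x t)).
  - destruct (Rbar_lt_locally_pos T t Ht HtT) as [d Hd]. exists d. intros [y s] [_ Hs].
    destruct (Hd s Hs) as [H1 H2]. apply Derive_correct.
    apply (C1_strip_ex_dx T f hf); [simpl; lra | exact H2].
  - apply Derive_correct, (C1_strip_ex_dt T f hf); assumption.
  - apply filterlim_strip_interior; [exact Ht|].
    exact (C1_strip_dx_cont T f hf x t (Rlt_le _ _ Ht) HtT).
Qed.

End Strip.

Section APriori.
Context (k c w : R) (rho0 u0 e : R -> R) (T : Rbar) (rho u E X : R -> R -> R).
Context (hw : 0 < w) (hc : 0 < c) (hww : w * w = - c * k).
Context (hrho0 : C1_line rho0) (hu0 : C1_line u0) (hpos : forall x, 0 < rho0 x).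
Context (he : forall x, is_derive e x (rho0 x - c)).
Context (hT : Rbar_lt 0 T).
Context (hsol : smooth_solution k c rho0 u0 T rho u E X).

Local Notation flow := (flow_map w c u0 e).
Local Notation velocity := (flow_velocity w c u0 e).
Local Notation jac := (flow_jac w c rho0 u0).
Local Notation jac_dt := (flow_jac_dt w c rho0 u0).

Lemma char_0 (a : R) : X a 0 = a.
Proof. apply (sol_char _ _ _ _ _ _ _ _ _ hsol). Qed.

Lemma char_at_right (a : R) : filterlim (X a) (at_right 0) (locally a).
Proof. apply (sol_char _ _ _ _ _ _ _ _ _ hsol). Qed.

Lemma char_is_derive (a t : R) :
  0 < t -> Rbar_lt t T -> is_derive (X a) t (u (X a t) t).
Proof. apply (sol_char _ _ _ _ _ _ _ _ _ hsol). Qed.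

Lemma rho_strip : continuous_strip T rho.
Proof. apply C1_strip_cont, (sol_rho_C1 _ _ _ _ _ _ _ _ _ hsol). Qed.

Lemma u_strip : continuous_strip T u.
Proof. apply C1_strip_cont, (sol_u_C1 _ _ _ _ _ _ _ _ _ hsol). Qed.

(** Characteristics are constrained for t >= 0 only. Clipping the time makes them continuous on both
    sides of 0, as two-sided continuity of parameter integrals requires. *)
Lemma char_clipped_continuous (a : R) : continuous (fun s => X a (Rmax 0 s)) 0.
Proof.
  apply filterlim_locally. intros eps. rewrite Rmax_left, char_0 by lra.
  destruct (proj1 (filterlim_locally (X a) a) (char_at_right a) eps) as [d Hd].
  exists d. intros s Hs. destruct (Rle_lt_dec s 0) as [H | H].
  - rewrite Rmax_left, char_0 by lra. apply ball_center.
  - rewrite Rmax_right by lra. apply Hd; assumption.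
Qed.

Lemma ex_RInt_rho (a b t : R) :
  0 <= t -> Rbar_lt t T -> ex_RInt (fun x => rho x t) a b.
Proof.
  intros Ht HtT. apply (ex_RInt_continuous (V := R_CompleteNormedModule)). intros x _.
  apply (continuous_strip_slice T rho rho_strip); assumption.
Qed.

Lemma dt_rho_continuity_2d (x t : R) : 0 < t -> Rbar_lt t T ->
  continuity_2d_pt (fun s y => Derive (fun z => rho y z) s) t x.
Proof.
  intros Ht HtT. apply continuity_2d_pt_filterlim.
  assert (H := C1_strip_dt_cont _ _ (sol_rho_C1 _ _ _ _ _ _ _ _ _ hsol) x t Ht HtT).
  apply (filterlim_comp _ _ _ (fun p : R * R => (snd p, fst p))
    (fun p => dt rho (fst p) (snd p)) _ (locally (x, t))); [|exact H].
  intros P [d Hd]. exists d. intros [s y] [H1 H2]. apply Hd. split; assumption.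
Qed.

(** In Leibniz' rule the integral of rho_t = - (rho u)_x produces boundary fluxes that cancel the
    terms from the moving endpoints. *)
Lemma is_derive_mass_between_chars (a b t : R) : 0 < t -> Rbar_lt t T ->
  is_derive (fun s => RInt (fun x => rho x s) (X a s) (X b s)) t 0.
Proof.
  intros Ht HtT.
  assert (Hloc := Rbar_lt_locally_pos T t Ht HtT).
  assert (Hint : forall y z, locally t (fun s => ex_RInt (fun x => rho x s) y z)).
  { intros y z. generalize Hloc. apply filter_imp. intros s [H1 H2].
    apply ex_RInt_rho; [lra | exact H2]. }
  assert (H2d : forall y, locally_2d
    (fun s x => continuity_2d_pt (fun s y => Derive (fun z => rho y z) s) s x) t y).
  { intros y. destruct Hloc as [d Hd]. exists d. intros s x Hs _.
    destruct (Hd s Hs) as [H1 H2]. apply dt_rho_continuity_2d; assumption. }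
  assert (Hslice : forall y, continuity_pt (fun x => rho x t) y).
  { intros y. apply continuity_pt_filterlim.
    apply (continuous_strip_slice T rho rho_strip); [lra | exact HtT]. }
  assert (Hflux : forall y, is_derive (fun x => - (rho x t * u x t)) y (dt rho y t)).
  { intros y.
    assert (H1 := C1_strip_ex_dx _ _ (sol_rho_C1 _ _ _ _ _ _ _ _ _ hsol) y t
                    (Rlt_le _ _ Ht) HtT).
    assert (H2 := C1_strip_ex_dx _ _ (sol_u_C1 _ _ _ _ _ _ _ _ _ hsol) y t
                    (Rlt_le _ _ Ht) HtT).
    assert (H3 := sol_mass _ _ _ _ _ _ _ _ _ hsol y t Ht HtT).
    unfold dx at 1 in H3. simpl in H3.
    replace (dt rho y t) with (- Derive (fun x => rho x t * u x t) y) by lra.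
    apply (is_derive_opp (fun x => rho x t * u x t)). apply Derive_correct.
    auto_derive. auto. }
  assert (Hval : RInt (fun x => Derive (fun s => rho x s) t) (X a t) (X b t) =
    - (rho (X b t) t * u (X b t) t) - - (rho (X a t) t * u (X a t) t)).
  { apply (is_RInt_unique (V := R_CompleteNormedModule)).
    apply (is_RInt_derive (V := R_CompleteNormedModule)
             (fun x => - (rho x t * u x t)) (fun x => dt rho x t)).
    - intros y _. apply Hflux.
    - intros y _.
      apply (filterlim_comp _ _ _ (fun y : R => (y, t)) (fun p => dt rho (fst p) (snd p)) _
               (locally (y, t))).
      + apply filterlim_pair; [apply filterlim_id | apply filterlim_const].
      + apply (C1_strip_dt_cont _ _ (sol_rho_C1 _ _ _ _ _ _ _ _ _ hsol)); assumption. }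
  assert (HD := is_derive_RInt_param_bound_comp (fun s x => rho x s) (X a) (X b) t
    (u (X a t) t) (u (X b t) t) (Hint _ _)
    (ex_intro _ (mkposreal 1 Rlt_0_1) (Hint _ _))
    (ex_intro _ (mkposreal 1 Rlt_0_1) (Hint _ _))
    (char_is_derive a t Ht HtT) (char_is_derive b t Ht HtT)).
  eapply is_derive_eq_val.
  - apply HD.
    + exists (mkposreal 1 Rlt_0_1). generalize Hloc. apply filter_imp. intros s [H1 H2] x _.
      apply (C1_strip_ex_dt _ _ (sol_rho_C1 _ _ _ _ _ _ _ _ _ hsol)); assumption.
    + intros x _. apply dt_rho_continuity_2d; assumption.
    + apply H2d.
    + apply H2d.
    + apply Hslice.
    + apply Hslice.
  - rewrite Hval. ring.
Qed.

(* The change of variables x = X a t + y (X b t - X a t) fixes the domain of integration. *)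
Lemma mass_between_chars_at_right (a b : R) :
  filterlim (fun s => RInt (fun x => rho x s) (X a s) (X b s)) (at_right 0)
    (locally (RInt rho0 a b)).
Proof.
  set (xa := fun s => X a (Rmax 0 s)). set (xb := fun s => X b (Rmax 0 s)).
  set (g := fun y s => (xb s - xa s) * rho ((xb s - xa s) * y + xa s) (Rmax 0 s)).
  assert (Hsub : forall s : R, Rbar_lt s T ->
    ex_RInt (fun y => g y s) 0 1 /\
    RInt (fun y => g y s) 0 1 = RInt (fun x => rho x (Rmax 0 s)) (xa s) (xb s)).
  { intros s HsT.
    assert (H0 : 0 <= Rmax 0 s) by apply Rmax_l.
    assert (HT' : Rbar_lt (Rmax 0 s) T) by (apply (Rmax_case 0 s (fun x => Rbar_lt x T)); assumption).
    assert (Hc : forall x, continuous (fun x => rho x (Rmax 0 s)) x).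
    { intros x. apply (continuous_strip_slice T rho rho_strip); assumption. }
    split.
    - apply (ex_RInt_continuous (V := R_CompleteNormedModule)). intros y _. unfold g.
      eapply filterlim_eq; [limits|].
      + apply (filterlim_comp_continuous (fun y => (xb s - xa s) * y + xa s)
                 (fun x => rho x (Rmax 0 s)) ((xb s - xa s) * y + xa s)); [|apply Hc].
        limits. apply filterlim_id.
      + reflexivity.
    - replace (xa s) with ((xb s - xa s) * 0 + xa s) at 1 by ring.
      replace (xb s) with ((xb s - xa s) * 1 + xa s) at 2 by ring.
      apply (RInt_comp_lin (V := R_CompleteNormedModule) (fun x => rho x (Rmax 0 s))).
      apply ex_RInt_rho; assumption. }
  assert (Hlim : continuous (fun s => RInt (fun y => g y s) 0 1) 0).
  { apply continuous_RInt_param; [lra | |].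
    - intros y _. apply continuity_2d_pt_filterlim. unfold g.
      assert (Ha : filterlim (fun p : R * R => xa (snd p)) (locally (y, 0)) (locally (xa 0))).
      { apply (filterlim_comp_continuous snd xa 0); [|apply char_clipped_continuous].
        apply (continuous_snd (U := R_UniformSpace) (V := R_UniformSpace)). }
      assert (Hb : filterlim (fun p : R * R => xb (snd p)) (locally (y, 0)) (locally (xb 0))).
      { apply (filterlim_comp_continuous snd xb 0); [|apply char_clipped_continuous].
        apply (continuous_snd (U := R_UniformSpace) (V := R_UniformSpace)). }
      assert (Hy : filterlim (fun p : R * R => fst p) (locally (y, 0)) (locally y)).
      { apply (continuous_fst (U := R_UniformSpace) (V := R_UniformSpace)). }
      assert (Hr : filterlim (fun p : R * R =>
          rho ((xb (snd p) - xa (snd p)) * fst p + xa (snd p)) (Rmax 0 (snd p)))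
        (locally (y, 0)) (locally (rho ((xb 0 - xa 0) * y + xa 0) (Rmax 0 0)))).
      { apply (continuous_strip_filterlim T rho rho_strip).
        - apply Rmax_l.
        - rewrite Rmax_left by lra. exact hT.
        - limits.
        - apply (filterlim_comp_continuous snd (Rmax 0) 0).
          + apply (continuous_snd (U := R_UniformSpace) (V := R_UniformSpace)).
          + apply continuous_Rmax_0.
        - apply filter_forall. intros p. apply Rmax_l. }
      limits.
    - generalize (open_Rbar_lt T 0 hT). apply filter_imp. intros s Hs. apply Hsub, Hs. }
  unfold continuous in Hlim. rewrite (proj2 (Hsub 0 hT)) in Hlim.
  assert (Hlim' := filterlim_filter_le_1 (G := at_right 0) _
    (filter_le_within (fun s => 0 < s)) Hlim).
  unfold xa, xb in Hlim'. rewrite Rmax_left, !char_0 in Hlim' by lra.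
  rewrite (RInt_ext (fun x => rho x 0) rho0) in Hlim'
    by (intros x _; apply (sol_rho_init _ _ _ _ _ _ _ _ _ hsol)).
  apply (filterlim_ext_loc (fun s => RInt (fun y => g y s) 0 1)); [|exact Hlim'].
  destruct (open_Rbar_lt T 0 hT) as [d Hd]. exists d. intros s Hsd Hs.
  rewrite (proj2 (Hsub s (Hd s Hsd))). unfold xa, xb. rewrite Rmax_right by lra. reflexivity.
Qed.

Lemma mass_between_chars (a b t : R) : 0 < t -> Rbar_lt t T ->
  RInt (fun x => rho x t) (X a t) (X b t) = RInt rho0 a b.
Proof.
  apply (is_derive_const_on_right T
           (fun s => RInt (fun x => rho x s) (X a s) (X b s))).
  - intros s. apply is_derive_mass_between_chars.
  - apply mass_between_chars_at_right.
Qed.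

(** Both sides of the first identity solve Z'' = w^2 Z + const with the same constant and the same
    initial data, so their difference falls under [hyperbolic_ode_zero]. Taking differences removes
    the additive constant of [e] and the function of time left free in E. *)
Lemma flow_velocity_differences (a b t : R) : 0 < t -> Rbar_lt t T ->
  X b t - X a t = flow b t - flow a t /\
  u (X b t) t - u (X a t) t = velocity b t - velocity a t.
Proof.
  intros Ht HtT.
  assert (Hu : forall y s, 0 < s -> Rbar_lt s T ->
    is_derive (fun r => u (X y r) r) s (k * E (X y s) s)).
  { intros y s Hs HsT. rewrite <- (sol_momentum _ _ _ _ _ _ _ _ _ hsol) by assumption.
    apply is_derive_Reals. eapply derivable_pt_lim_eq_val.
    - apply (derivable_pt_lim_comp_2d u (X y) (fun r => r)).
      + apply (C1_strip_differentiable T); [|assumption..].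
        apply (sol_u_C1 _ _ _ _ _ _ _ _ _ hsol).
      + apply is_derive_Reals, char_is_derive; assumption.
      + apply derivable_pt_lim_id.
    - ring. }
  (* Poisson's equation makes [E + c x] an antiderivative of the density, so the conserved mass
     fixes the force difference up to the distance of the two characteristics. *)
  assert (Hforce : forall s, 0 < s -> Rbar_lt s T ->
    E (X b s) s - E (X a s) s = (e b - e a + c * (b - a)) - c * (X b s - X a s)).
  { intros s Hs HsT.
    assert (H1 : is_RInt (fun x => rho x s) (X a s) (X b s)
      ((E (X b s) s + c * X b s) - (E (X a s) s + c * X a s))).
    { apply (is_RInt_derive (V := R_CompleteNormedModule) (fun x => E x s + c * x)).
      - intros x _.
        assert (H := sol_poisson _ _ _ _ _ _ _ _ _ hsol x s Hs HsT).
        auto_derive; [exists (rho x s - c); exact H|].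
        rewrite (Derive_eta (fun y => E y s) _ _ H). ring.
      - intros x _. apply (continuous_strip_slice T rho rho_strip); [lra | assumption]. }
    assert (H2 : is_RInt rho0 a b ((e b + c * b) - (e a + c * a))).
    { apply (is_RInt_derive (V := R_CompleteNormedModule) (fun x => e x + c * x)).
      - intros x _. assert (H := he x). auto_derive; [exists (rho0 x - c); exact H|].
        rewrite (Derive_eta _ _ _ H). ring.
      - intros x _. apply C1_line_continuous, hrho0. }
    assert (H := mass_between_chars a b s Hs HsT).
    rewrite (is_RInt_unique _ _ _ _ H1), (is_RInt_unique _ _ _ _ H2) in H. lra. }
  assert (Hlim : forall y, filterlim (fun s => u (X y s) s) (at_right 0) (locally (u0 y))).
  { intros y. rewrite <- (sol_u_init _ _ _ _ _ _ _ _ _ hsol).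
    apply (continuous_strip_filterlim T u u_strip); [lra | exact hT | apply char_at_right | |].
    - apply filter_le_within.
    - exists (mkposreal 1 Rlt_0_1). intros s _ Hs. lra. }
  assert (Hcont : forall g : R -> R, ex_derive g 0 ->
    filterlim g (at_right 0) (locally (g 0))).
  { intros g Hg. apply (filterlim_filter_le_1 (F := locally 0)); [apply filter_le_within|].
    apply (@ex_derive_continuous R_AbsRing R_NormedModule), Hg. }
  assert (Hf : forall y, filterlim (flow y) (at_right 0) (locally y)).
  { intros y. rewrite <- (flow_0 w c u0 e y) at 2. apply Hcont.
    eexists. apply is_derive_flow_dt; assumption. }
  assert (Hv : forall y, filterlim (velocity y) (at_right 0) (locally (u0 y))).
  { intros y. rewrite <- (velocity_0 w c u0 e y) at 1. apply Hcont.
    eexists. apply is_derive_velocity_dt; assumption. }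
  destruct (hyperbolic_ode_zero T w
    (fun s => (X b s - X a s) - (flow b s - flow a s))
    (fun s => (u (X b s) s - u (X a s) s) - (velocity b s - velocity a s)) hw) with (t := t)
    as [H1 H2]; try assumption.
  - intros s Hs HsT.
    apply (is_derive_minus (V := R_NormedModule) (fun s => X b s - X a s)
             (fun s => flow b s - flow a s)).
    + apply (is_derive_minus (V := R_NormedModule)); apply char_is_derive; assumption.
    + apply (is_derive_minus (V := R_NormedModule)); apply is_derive_flow_dt; assumption.
  - intros s Hs HsT. eapply is_derive_eq_val.
    + apply (is_derive_minus (V := R_NormedModule) (fun s => u (X b s) s - u (X a s) s)
             (fun s => velocity b s - velocity a s)).
      * apply (is_derive_minus (V := R_NormedModule)); apply Hu; assumption.
      * apply (is_derive_minus (V := R_NormedModule)); apply is_derive_velocity_dt; assumption.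
    + unfold minus, plus, opp; simpl.
      replace (k * E (X b s) s + - (k * E (X a s) s)) with
        (- (w * w) / c * (E (X b s) s - E (X a s) s)) by (rewrite hww; field; lra).
      rewrite Hforce by assumption. unfold flow_map, flow_force. field. lra.
  - eapply filterlim_eq.
    + assert (Ha := char_at_right a). assert (Hb := char_at_right b).
      assert (Hfa := Hf a). assert (Hfb := Hf b). limits.
    + ring.
  - eapply filterlim_eq.
    + assert (Ha := Hlim a). assert (Hb := Hlim b).
      assert (Hva := Hv a). assert (Hvb := Hv b). limits.
    + ring.
  - lra.
Qed.

(** The true flow may differ from the explicit one by a translation that depends on time but not on
    the label; differentiation in the label therefore does not see it. *)
Lemma char_eq_flow_plus (a b t : R) : 0 <= t -> Rbar_lt t T ->
  X b t = flow b t + (X a t - flow a t).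
Proof.
  intros [Ht | <-] HtT.
  - assert (H := proj1 (flow_velocity_differences a b t Ht HtT)). lra.
  - rewrite !char_0, !flow_0. ring.
Qed.

Lemma u_char_eq_velocity_plus (a b t : R) : 0 <= t -> Rbar_lt t T ->
  u (X b t) t = velocity b t + (u (X a t) t - velocity a t).
Proof.
  intros [Ht | <-] HtT.
  - assert (H := proj2 (flow_velocity_differences a b t Ht HtT)). lra.
  - rewrite !char_0, !velocity_0, !(sol_u_init _ _ _ _ _ _ _ _ _ hsol). ring.
Qed.

Lemma is_derive_char_da (a t : R) : 0 <= t -> Rbar_lt t T ->
  is_derive (fun b => X b t) a (jac a t).
Proof.
  intros Ht HtT. apply (is_derive_ext (fun b => flow b t + (X a t - flow a t))).
  - intros b. symmetry. apply char_eq_flow_plus; assumption.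
  - assert (H := is_derive_flow_da w c rho0 u0 e hw hc hu0 he a t).
    auto_derive; [exists (jac a t); exact H|].
    rewrite (Derive_eta (fun b => flow b t) _ _ H). ring.
Qed.

(** The chain rule for u (X b t) t in the label. The identity stays multiplied out because
    positivity of [jac] is a later consequence of the companion identity for the density. *)
Lemma u_x_char_mul_jac (a t : R) : 0 <= t -> Rbar_lt t T ->
  dx u (X a t) t * jac a t = jac_dt a t.
Proof.
  intros Ht HtT.
  assert (H1 : is_derive (fun b => u (X b t) t) a (jac_dt a t)).
  { apply (is_derive_ext (fun b => velocity b t + (u (X a t) t - velocity a t))).
    - intros b. symmetry. apply u_char_eq_velocity_plus; assumption.
    - assert (H := is_derive_velocity_da w c rho0 u0 e hc hu0 he a t).
      auto_derive; [exists (jac_dt a t); exact H|].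
      rewrite (Derive_eta (fun b => velocity b t) _ _ H). ring. }
  assert (H2 : is_derive (fun b => u (X b t) t) a (jac a t * dx u (X a t) t)).
  { apply (is_derive_comp (fun x => u x t) (fun b => X b t)).
    - apply Derive_correct.
      apply (C1_strip_ex_dx _ _ (sol_u_C1 _ _ _ _ _ _ _ _ _ hsol)); assumption.
    - apply is_derive_char_da; assumption. }
  rewrite Rmult_comm, <- (is_derive_unique _ _ _ H2). apply is_derive_unique, H1.
Qed.

(** This is the derivative in b, at b = a, of the conserved mass between the characteristics of a
    and b. *)
Lemma rho_char_mul_jac (a t : R) : 0 <= t -> Rbar_lt t T ->
  rho (X a t) t * jac a t = rho0 a.
Proof.
  intros [Ht | <-] HtT.
  2:{ rewrite char_0, (sol_rho_init _ _ _ _ _ _ _ _ _ hsol). unfold flow_jac.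
      rewrite jacobian_0. ring. }
  set (P := fun x => RInt (fun y => rho y t) (X a t) x).
  assert (HP : forall x, is_derive P x (rho x t)).
  { intros x. apply (is_derive_RInt (fun y => rho y t) P (X a t) x).
    - apply filter_forall. intros b. apply (RInt_correct (V := R_CompleteNormedModule)).
      apply ex_RInt_rho; [lra | assumption].
    - apply (continuous_strip_slice T rho rho_strip); [lra | assumption]. }
  assert (H1 : is_derive (fun b => P (X b t)) a (rho0 a)).
  { apply (is_derive_ext (fun b => RInt rho0 a b)).
    - intros b. symmetry. apply mass_between_chars; assumption.
    - apply (is_derive_RInt rho0 (RInt rho0 a) a a); [|apply C1_line_continuous, hrho0].
      apply filter_forall. intros b. apply (RInt_correct (V := R_CompleteNormedModule)).
      apply (ex_RInt_continuous (V := R_CompleteNormedModule)). intros z _.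
      apply C1_line_continuous, hrho0. }
  assert (H2 : is_derive (fun b => P (X b t)) a (jac a t * rho (X a t) t)).
  { apply (is_derive_comp P (fun b => X b t)); [apply HP|].
    apply is_derive_char_da; [lra | assumption]. }
  rewrite Rmult_comm, <- (is_derive_unique _ _ _ H2). apply is_derive_unique, H1.
Qed.

(** A zero of [jac] would contradict rho J = rho0 > 0, and J starts from 1, so it cannot change
    sign. *)
Lemma jac_pos (a t : R) : 0 <= t -> Rbar_lt t T -> 0 < jac a t.
Proof.
  intros Ht HtT. destruct (Rlt_le_dec 0 (jac a t)) as [H | H]; [exact H|]. exfalso.
  assert (H0 : flow_jac w c rho0 u0 a 0 = 1) by apply jacobian_0.
  destruct (IVT_gen (jac a) 0 t 0) as [s [Hs Hs0]].
  - apply continuity_jacobian, hw.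
  - rewrite H0, Rmin_right, Rmax_left by lra. lra.
  - rewrite Rmin_left, Rmax_right in Hs by exact Ht.
    assert (Hr := rho_char_mul_jac a s (proj1 Hs)
                    (Rbar_le_lt_trans s t T (proj2 Hs) HtT)).
    rewrite Hs0 in Hr. specialize (hpos a). lra.
Qed.

Lemma rho_char (a t : R) : 0 <= t -> Rbar_lt t T -> rho (X a t) t = rho0 a / jac a t.
Proof.
  intros Ht HtT. assert (H := jac_pos a t Ht HtT).
  rewrite <- (rho_char_mul_jac a t Ht HtT). field. lra.
Qed.

Lemma u_x_char (a t : R) : 0 <= t -> Rbar_lt t T -> dx u (X a t) t = jac_dt a t / jac a t.
Proof.
  intros Ht HtT. assert (H := jac_pos a t Ht HtT).
  rewrite <- (u_x_char_mul_jac a t Ht HtT). field. lra.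
Qed.

(** * Identification of the flow under decay at infinity *)

Context (hu0p : is_lim u0 p_infty 0) (hu0m : is_lim u0 m_infty 0).
Context (hep : is_lim e p_infty 0) (hem : is_lim e m_infty 0).

Lemma is_lim_char_p_infty (t : R) : 0 <= t -> Rbar_lt t T ->
  is_lim (fun a => X a t) p_infty p_infty.
Proof.
  intros Ht HtT. apply is_lim_infty_of_minus_id with (0 + (X 0 t - flow 0 t)).
  apply (filterlim_ext (fun a => (flow a t - a) + (X 0 t - flow 0 t))).
  - intros a. rewrite (char_eq_flow_plus 0 a t) by assumption. ring.
  - assert (H := filterlim_flow_minus_id (F := Rbar_locally p_infty) w c u0 e hw hc t hu0p hep).
    limits.
Qed.

Lemma is_lim_char_m_infty (t : R) : 0 <= t -> Rbar_lt t T ->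
  is_lim (fun a => X a t) m_infty m_infty.
Proof.
  intros Ht HtT. apply is_lim_minfty_of_minus_id with (0 + (X 0 t - flow 0 t)).
  apply (filterlim_ext (fun a => (flow a t - a) + (X 0 t - flow 0 t))).
  - intros a. rewrite (char_eq_flow_plus 0 a t) by assumption. ring.
  - assert (H := filterlim_flow_minus_id (F := Rbar_locally m_infty) w c u0 e hw hc t hu0m hem).
    limits.
Qed.

Lemma char_surjective (x t : R) : 0 <= t -> Rbar_lt t T -> exists a, X a t = x.
Proof.
  intros Ht HtT.
  destruct (IVT_Rbar_incr (fun a => X a t) m_infty p_infty m_infty p_infty x)
    as [a [_ [_ Ha]]]; simpl; auto.
  - apply is_lim_char_m_infty; assumption.
  - apply is_lim_char_p_infty; assumption.
  - intros a _ _. apply continuity_pt_filterlim.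
    apply (@ex_derive_continuous R_AbsRing R_NormedModule (fun b => X b t)).
    exists (jac a t). apply is_derive_char_da; assumption.
  - exists a. exact Ha.
Qed.

(** The difference between u along the characteristic and the explicit velocity is independent of
    the label. Sending the label to infinity, where both tend to 0, shows that it vanishes. *)
Lemma u_char (a t : R) : 0 <= t -> Rbar_lt t T -> is_lim (fun x => u x t) p_infty 0 ->
  u (X a t) t = velocity a t.
Proof.
  intros Ht HtT Hlim.
  assert (H1 : filterlim (fun b => u (X b t) t) (Rbar_locally p_infty) (locally 0)).
  { apply (filterlim_comp _ _ _ (fun b => X b t) (fun x => u x t) _ (Rbar_locally p_infty)).
    - apply is_lim_char_p_infty; assumption.
    - exact Hlim. }
  assert (H2 : filterlim (fun b => u (X b t) t) (Rbar_locally p_infty)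
                 (locally (0 + (u (X a t) t - velocity a t)))).
  { apply (filterlim_ext (fun b => velocity b t + (u (X a t) t - velocity a t))).
    - intros b. symmetry. apply u_char_eq_velocity_plus; assumption.
    - assert (H := filterlim_velocity (F := Rbar_locally p_infty) w c u0 e t hu0p hep). limits. }
  assert (H := filterlim_locally_unique (K := R_AbsRing) (V := R_NormedModule) _ _ _ H1 H2).
  lra.
Qed.

(** The translation left free by [char_eq_flow_plus] has derivative 0 by [u_char] and starts from
    0. *)
Lemma char_eq_flow (a t : R) : 0 <= t -> Rbar_lt t T ->
  (forall s, 0 <= s -> Rbar_lt s T -> is_lim (fun x => u x s) p_infty 0) ->
  X a t = flow a t.
Proof.
  intros [Ht | <-] HtT Hlim; [|rewrite char_0, flow_0; reflexivity].
  assert (H : X a t - flow a t = 0); [|lra].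
  apply (is_derive_const_on_right T (fun s => X a s - flow a s)); try assumption.
  - intros s Hs HsT. eapply is_derive_eq_val.
    + apply (is_derive_minus (V := R_NormedModule) (X a) (flow a)).
      * apply char_is_derive; assumption.
      * apply is_derive_flow_dt; assumption.
    + unfold minus, plus, opp; simpl. rewrite u_char; [ring | lra | assumption |].
      apply Hlim; [lra | assumption].
  - eapply filterlim_eq.
    + limits; [apply char_at_right|].
      apply (filterlim_filter_le_1 (F := locally 0)); [apply filter_le_within|].
      apply (@ex_derive_continuous R_AbsRing R_NormedModule (flow a) 0).
      eexists. apply is_derive_flow_dt; assumption.
    + rewrite flow_0. ring.
Qed.

End APriori.

(** * Solutions built from the flow *)

Section Construction.
Context (k c w : R) (rho0 u0 e : R -> R) (T : Rbar).
Context (hw : 0 < w) (hc : 0 < c) (hww : w * w = - c * k).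
Context (hrho0 : C1_line rho0) (hu0 : C1_line u0) (hdu0 : C1_line (Derive u0)).
Context (he : forall x, is_derive e x (rho0 x - c)).
Context (hrho0p : is_lim rho0 p_infty c) (hrho0m : is_lim rho0 m_infty c).
Context (hu0p : is_lim u0 p_infty 0) (hu0m : is_lim u0 m_infty 0).
Context (hdu0p : is_lim (Derive u0) p_infty 0) (hdu0m : is_lim (Derive u0) m_infty 0).
Context (hep : is_lim e p_infty 0) (hem : is_lim e m_infty 0).

Local Notation flow := (flow_map w c u0 e).
Local Notation velocity := (flow_velocity w c u0 e).
Local Notation force := (flow_force w c u0 e).
Local Notation jac := (flow_jac w c rho0 u0).
Local Notation jac_dt := (flow_jac_dt w c rho0 u0).

Lemma filterlim_jac_infty (F : (R -> Prop) -> Prop) {FF : Filter F} (t : R) :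
  filterlim rho0 F (locally c) -> filterlim (Derive u0) F (locally 0) ->
  filterlim (fun a => jac a t) F (locally 1).
Proof.
  intros Hr Hu. unfold flow_jac, jacobian. eapply filterlim_eq; [limits; lra | field; lra].
Qed.

Context (hjac : forall a t, 0 <= t -> Rbar_lt t T -> 0 < jac a t).

Lemma flow_increasing (a b t : R) : 0 <= t -> Rbar_lt t T -> a < b -> flow a t < flow b t.
Proof.
  intros Ht HtT Hab.
  apply (incr_function (fun x => flow x t) m_infty p_infty (fun x => jac x t));
    simpl; auto; intros x _ _.
  - apply is_derive_flow_da; assumption.
  - apply hjac; assumption.
Qed.

Lemma flow_surjective (x t : R) : exists a, flow a t = x.
Proof.
  destruct (IVT_Rbar_incr (fun a => flow a t) m_infty p_infty m_infty p_infty x)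
    as [a [_ [_ Ha]]]; simpl; auto.
  - apply is_lim_minfty_of_minus_id with 0, filterlim_flow_minus_id; assumption || typeclasses eauto.
  - apply is_lim_infty_of_minus_id with 0, filterlim_flow_minus_id; assumption || typeclasses eauto.
  - intros a _ _. apply continuity_pt_filterlim.
    apply (@ex_derive_continuous R_AbsRing R_NormedModule (fun b => flow b t)).
    exists (jac a t). apply is_derive_flow_da; assumption.
  - exists a. exact Ha.
Qed.

(** This is the inverse of the flow at time t. Surjectivity holds at every real t, so [flow_label]
    carries no time bounds; positivity of [jac] enters through uniqueness of the preimage. *)
Definition label (x t : R) : R := epsilon (inhabits 0) (fun a => flow a t = x).

Lemma flow_label (x t : R) : flow (label x t) t = x.
Proof. unfold label. apply epsilon_spec, flow_surjective. Qed.

Lemma label_flow (a t : R) : 0 <= t -> Rbar_lt t T -> label (flow a t) t = a.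
Proof.
  intros Ht HtT. assert (H := flow_label (flow a t) t).
  destruct (Rtotal_order (label (flow a t) t) a) as [Hl | [Hl | Hl]]; [|exact Hl|];
    apply (flow_increasing _ _ t Ht HtT) in Hl; lra.
Qed.

Lemma lt_label (a x t : R) : 0 <= t -> Rbar_lt t T -> flow a t < x -> a < label x t.
Proof.
  intros Ht HtT Hx. destruct (Rlt_le_dec a (label x t)) as [H | [H | H]]; [exact H| |].
  - apply (flow_increasing _ _ t Ht HtT) in H. rewrite flow_label in H. lra.
  - rewrite <- H, flow_label in Hx. lra.
Qed.

Lemma label_lt (a x t : R) : 0 <= t -> Rbar_lt t T -> x < flow a t -> label x t < a.
Proof.
  intros Ht HtT Hx. destruct (Rlt_le_dec (label x t) a) as [H | [H | H]]; [exact H| |].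
  - apply (flow_increasing _ _ t Ht HtT) in H. rewrite flow_label in H. lra.
  - rewrite H, flow_label in Hx. lra.
Qed.

(** The strict inequalities flow (a - eps) t < x < flow (a + eps) t persist at nearby points of the
    half plane, and monotonicity of the flow turns them into bounds on the label. *)
Lemma label_strip : continuous_strip T label.
Proof.
  intros x t Ht HtT. apply filterlim_locally. intros eps.
  set (a := label x t). set (F := within (fun p : R * R => 0 <= snd p) (locally (x, t))).
  assert (Hx : flow a t = x) by apply flow_label.
  assert (H1 : flow (a - eps) t < x).
  { rewrite <- Hx. apply flow_increasing; try assumption. pose proof (cond_pos eps). lra. }
  assert (H2 : x < flow (a + eps) t).
  { rewrite <- Hx at 1. apply flow_increasing; try assumption. pose proof (cond_pos eps). lra. }
  assert (Hfst : filterlim fst F (locally x)).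
  { apply (filterlim_filter_le_1 (F := locally (x, t))); [apply filter_le_within|].
    apply (continuous_fst (U := R_UniformSpace) (V := R_UniformSpace)). }
  assert (Hsnd : filterlim snd F (locally t)).
  { apply (filterlim_filter_le_1 (F := locally (x, t))); [apply filter_le_within|].
    apply (continuous_snd (U := R_UniformSpace) (V := R_UniformSpace)). }
  assert (Hflow : forall b, filterlim (fun p => flow b (snd p)) F (locally (flow b t))).
  { intros b. apply (filterlim_comp_continuous snd (flow b) t); [exact Hsnd|].
    apply (@ex_derive_continuous R_AbsRing R_NormedModule).
    exists (velocity b t). apply is_derive_flow_dt; assumption. }
  assert (HT : F (fun p => Rbar_lt (snd p) T)) by exact (Hsnd _ (open_Rbar_lt T t HtT)).
  assert (Hpos : F (fun p => 0 <= snd p)).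
  { unfold F, within. apply filter_forall. intros p Hp. exact Hp. }
  assert (Hl : F (fun p => flow (a - eps) (snd p) - fst p < 0)).
  { assert (Hlim : filterlim (fun p => flow (a - eps) (snd p) - fst p) F
                     (locally (flow (a - eps) t - x))).
    { apply filterlim_Rminus; [apply Hflow | exact Hfst]. }
    apply (Hlim (fun y => y < 0)), open_lt. lra. }
  assert (Hr : F (fun p => 0 < flow (a + eps) (snd p) - fst p)).
  { assert (Hlim : filterlim (fun p => flow (a + eps) (snd p) - fst p) F
                     (locally (flow (a + eps) t - x))).
    { apply filterlim_Rminus; [apply Hflow | exact Hfst]. }
    apply (Hlim (fun y => 0 < y)). apply open_gt. lra. }
  generalize (filter_and _ _ (filter_and _ _ HT Hpos) (filter_and _ _ Hl Hr)).
  apply filter_imp. intros [y s] [[H3 H4] [H5 H6]]. simpl in *.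
  assert (a - eps < label y s) by (apply lt_label; [assumption..|lra]).
  assert (label y s < a + eps) by (apply label_lt; [assumption..|lra]).
  apply Rabs_def1; unfold minus, plus, opp; simpl; lra.
Qed.

Lemma continuous_strip_lift (G : R -> R -> R) :
  (forall a t, 0 <= t -> Rbar_lt t T -> continuous (fun p => G (fst p) (snd p)) (a, t)) ->
  continuous_strip T (fun x t => G (label x t) t).
Proof.
  intros HG x t Ht HtT.
  apply (filterlim_comp _ _ _ (fun p => (label (fst p) (snd p), snd p))
    (fun p => G (fst p) (snd p)) _ (locally (label x t, t))); [|apply HG; assumption].
  apply filterlim_pair.
  - apply label_strip; assumption.
  - apply (filterlim_filter_le_1 (F := locally (x, t))); [apply filter_le_within|].
    apply (continuous_snd (U := R_UniformSpace) (V := R_UniformSpace)).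
Qed.

Section JointContinuity.
Context (a t : R).

Lemma filterlim_comp_fst (f : R -> R) : continuous f a ->
  filterlim (fun p : R * R => f (fst p)) (locally (a, t)) (locally (f a)).
Proof.
  apply filterlim_comp_continuous.
  apply (continuous_fst (U := R_UniformSpace) (V := R_UniformSpace)).
Qed.

Lemma filterlim_comp_snd (f : R -> R) : continuous f t ->
  filterlim (fun p : R * R => f (snd p)) (locally (a, t)) (locally (f t)).
Proof.
  apply filterlim_comp_continuous.
  apply (continuous_snd (U := R_UniformSpace) (V := R_UniformSpace)).
Qed.

Lemma e_continuous (x : R) : continuous e x.
Proof.
  apply (@ex_derive_continuous R_AbsRing R_NormedModule). exists (rho0 x - c). apply he.
Qed.

Lemma cosh_scal_continuous (s : R) : continuous (fun s => cosh (w * s)) s.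
Proof.
  apply (@ex_derive_continuous R_AbsRing R_NormedModule (fun s => cosh (w * s))).
  eexists. apply is_derive_cosh_scal.
Qed.

Lemma sinh_scal_continuous (s : R) : continuous (fun s => sinh (w * s)) s.
Proof.
  apply (@ex_derive_continuous R_AbsRing R_NormedModule (fun s => sinh (w * s))).
  eexists. apply is_derive_sinh_scal.
Qed.

End JointContinuity.

(** Places the joint continuity of every ingredient in the context, where [limits] finds it by
    [eassumption]. *)
Ltac joint a t :=
  let H1 := fresh in let H2 := fresh in let H3 := fresh in let H4 := fresh in
  let H5 := fresh in let H6 := fresh in let H7 := fresh in let H8 := fresh in
  assert (H1 := filterlim_comp_fst a t rho0 (C1_line_continuous _ _ hrho0));
  assert (H2 := filterlim_comp_fst a t u0 (C1_line_continuous _ _ hu0));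
  assert (H3 := filterlim_comp_fst a t (Derive u0) (C1_line_continuous _ _ hdu0));
  assert (H4 := filterlim_comp_fst a t e (e_continuous a));
  assert (H5 := filterlim_comp_snd a t _ (cosh_scal_continuous t));
  assert (H6 := filterlim_comp_snd a t _ (sinh_scal_continuous t));
  assert (H7 := filterlim_comp_fst a t (Derive rho0) (proj2 (hrho0 a)));
  assert (H8 := filterlim_comp_fst a t (Derive (Derive u0)) (proj2 (hdu0 a)));
  cbv beta in H5, H6; limits.

Lemma jac_continuous (a t : R) : continuous (fun p => jac (fst p) (snd p)) (a, t).
Proof. unfold continuous, flow_jac, jacobian. joint a t; lra. Qed.

Lemma jac_dt_continuous (a t : R) : continuous (fun p => jac_dt (fst p) (snd p)) (a, t).
Proof. unfold continuous, flow_jac_dt, jacobian_dt. joint a t; lra. Qed.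

Lemma velocity_continuous (a t : R) : continuous (fun p => velocity (fst p) (snd p)) (a, t).
Proof. unfold continuous, flow_velocity. joint a t; lra. Qed.

Lemma velocity_dt_continuous (a t : R) :
  continuous (fun p => - (w * w) / c * force (fst p) (snd p)) (a, t).
Proof. unfold continuous, flow_force. joint a t; lra. Qed.

Definition density (a t : R) : R := rho0 a / jac a t.

Definition jac_da (a t : R) : R :=
  Derive rho0 a / c * (1 - cosh (w * t)) + Derive (Derive u0) a / w * sinh (w * t).

Definition density_da (a t : R) : R :=
  (Derive rho0 a * jac a t - rho0 a * jac_da a t) / (jac a t * jac a t).

Definition density_dt (a t : R) : R := - (rho0 a * jac_dt a t) / (jac a t * jac a t).

Lemma is_derive_jac_da (a t : R) : is_derive (fun b => jac b t) a (jac_da a t).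
Proof.
  unfold flow_jac, jac_da, jacobian. assert (H1 := C1_line_is_derive rho0 a hrho0).
  assert (H2 := C1_line_is_derive (Derive u0) a hdu0). auto_derive.
  - repeat split; trivial; eexists; eassumption.
  - rewrite (Derive_eta _ _ _ H1), (Derive_eta (Derive u0) _ _ H2). field. lra.
Qed.

Lemma is_derive_density_da (a t : R) : jac a t <> 0 ->
  is_derive (fun b => density b t) a (density_da a t).
Proof.
  intros Hj. unfold density, density_da.
  assert (H1 := C1_line_is_derive rho0 a hrho0). assert (H2 := is_derive_jac_da a t).
  auto_derive.
  - repeat split; try (eexists; eassumption). exact Hj.
  - rewrite (Derive_eta _ _ _ H1), (Derive_eta (fun b => jac b t) _ _ H2). field. exact Hj.
Qed.

Lemma is_derive_density_dt (a t : R) : jac a t <> 0 ->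
  is_derive (density a) t (density_dt a t).
Proof.
  intros Hj. unfold density, density_dt.
  assert (H1 : is_derive (jac a) t (jac_dt a t)) by (apply is_derive_jacobian, hw).
  auto_derive.
  - repeat split; [eexists; eassumption | exact Hj].
  - rewrite (Derive_eta (fun x => jac a x) _ _ H1). field. exact Hj.
Qed.

Lemma density_continuous (a t : R) : jac a t <> 0 ->
  continuous (fun p => density (fst p) (snd p)) (a, t).
Proof.
  intros Hj. assert (H := jac_continuous a t). unfold continuous, density in *.
  joint a t; exact Hj.
Qed.

Lemma density_da_continuous (a t : R) : jac a t <> 0 ->
  continuous (fun p => density_da (fst p) (snd p)) (a, t).
Proof.
  intros Hj. assert (H := jac_continuous a t). unfold continuous, density_da, jac_da in *.
  joint a t; try lra. apply Rmult_integral_contrapositive; auto.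
Qed.

Lemma density_dt_continuous (a t : R) : jac a t <> 0 ->
  continuous (fun p => density_dt (fst p) (snd p)) (a, t).
Proof.
  intros Hj. assert (H := jac_continuous a t). assert (H' := jac_dt_continuous a t).
  unfold continuous, density_dt in *. joint a t; try lra. apply Rmult_integral_contrapositive; auto.
Qed.

Lemma differentiable_of_partials (G Ga : R -> R -> R) (a t l : R) :
  locally t (fun s => forall b, is_derive (fun b => G b s) b (Ga b s)) ->
  is_derive (G a) t l -> continuous (fun p => Ga (fst p) (snd p)) (a, t) ->
  differentiable_pt_lim G a t (Ga a t) l.
Proof.
  intros HGa HGt Hc. apply filterdiff_differentiable_pt_lim.
  apply (is_derive_filterdiff G a t Ga l).
  - destruct HGa as [d Hd]. exists d. intros [b s] [_ Hs]. apply Hd, Hs.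
  - exact HGt.
  - exact Hc.
Qed.

(** The label is the zero level of [flow a t - y], whose partial derivatives are J and -1;
    continuity of the label is already known, as [is_derive_implicit] demands. *)
Lemma is_derive_label_dx (x t : R) : 0 <= t -> Rbar_lt t T ->
  is_derive (fun y => label y t) x (/ jac (label x t) t).
Proof.
  intros Ht HtT. assert (Hj := hjac (label x t) t Ht HtT).
  apply is_derive_eq_val with (- -1 / jac (label x t) t); [|field; lra].
  apply (is_derive_implicit (fun a y => flow a t - y)).
  - apply (differentiable_of_partials (fun a y => flow a t - y) (fun a _ => jac a t)).
    + apply filter_forall. intros y b.
      assert (H := is_derive_flow_da w c rho0 u0 e hw hc hu0 he b t).
      auto_derive; [exists (jac b t); exact H|].
      rewrite (Derive_eta (fun b => flow b t) _ _ H). ring.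
    + auto_derive; trivial.
    + apply (filterlim_comp_fst (label x t) x (fun a => jac a t)).
      apply (filterlim_comp _ _ _ (fun a : R => (a, t)) (fun p => jac (fst p) (snd p)) _
               (locally (label x t, t))).
      * apply filterlim_pair; [apply filterlim_id | apply filterlim_const].
      * apply jac_continuous.
  - lra.
  - apply (continuous_strip_slice T label label_strip); assumption.
  - apply filter_forall. intros y. rewrite !flow_label. ring.
Qed.

Lemma is_derive_label_dt (x t : R) : 0 < t -> Rbar_lt t T ->
  is_derive (label x) t (- velocity (label x t) t / jac (label x t) t).
Proof.
  intros Ht HtT. assert (Hj := hjac (label x t) t (Rlt_le _ _ Ht) HtT).
  apply (is_derive_implicit flow).
  - apply differentiable_of_partials.
    + apply filter_forall. intros s b. apply is_derive_flow_da; assumption.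
    + apply is_derive_flow_dt; assumption.
    + apply jac_continuous.
  - lra.
  - apply (continuous_strip_filterlim T label label_strip (fun _ => x) (fun s => s));
      [lra | assumption | apply filterlim_const | apply filterlim_id |].
    generalize (open_gt 0 t Ht). apply filter_imp. intros s Hs. lra.
  - apply filter_forall. intros s. rewrite !flow_label. reflexivity.
Qed.

(** * Eulerian fields transported by the flow *)

Section Lift.
Context (G Ga Gt : R -> R -> R).
Context (hGa : forall a t, 0 <= t -> Rbar_lt t T -> is_derive (fun b => G b t) a (Ga a t)).
Context (hGt : forall a t, 0 <= t -> Rbar_lt t T -> is_derive (G a) t (Gt a t)).
Context (hG : forall a t, 0 <= t -> Rbar_lt t T ->
  continuous (fun p => G (fst p) (snd p)) (a, t)).
Context (hGac : forall a t, 0 <= t -> Rbar_lt t T ->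
  continuous (fun p => Ga (fst p) (snd p)) (a, t)).
Context (hGtc : forall a t, 0 <= t -> Rbar_lt t T ->
  continuous (fun p => Gt (fst p) (snd p)) (a, t)).

Lemma is_derive_lift_dx (x t : R) : 0 <= t -> Rbar_lt t T ->
  is_derive (fun y => G (label y t) t) x (Ga (label x t) t / jac (label x t) t).
Proof.
  intros Ht HtT.
  apply is_derive_eq_val with (/ jac (label x t) t * Ga (label x t) t).
  - apply (is_derive_comp (fun b => G b t) (fun y => label y t)).
    + apply hGa; assumption.
    + apply is_derive_label_dx; assumption.
  - apply Rmult_comm.
Qed.

(** [Gt] is the material derivative, so the convective term, velocity times [Ga / jac], is
    subtracted to obtain the time derivative at fixed x. *)
Lemma is_derive_lift_dt (x t : R) : 0 < t -> Rbar_lt t T ->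
  is_derive (fun s => G (label x s) s) t
    (Gt (label x t) t - Ga (label x t) t * velocity (label x t) t / jac (label x t) t).
Proof.
  intros Ht HtT. apply is_derive_Reals.
  eapply derivable_pt_lim_eq_val.
  - apply (derivable_pt_lim_comp_2d G (label x) (fun s => s)).
    + apply differentiable_of_partials with (Ga := Ga).
      * generalize (Rbar_lt_locally_pos T t Ht HtT). apply filter_imp. intros s [H1 H2] b.
        apply hGa; [lra | assumption].
      * apply hGt; [lra | assumption].
      * apply hGac; [lra | assumption].
    + apply is_derive_Reals, is_derive_label_dt; assumption.
    + apply derivable_pt_lim_id.
  - unfold Rdiv. ring.
Qed.

Lemma C1_strip_lift : C1_strip T (fun x t => G (label x t) t).
Proof.
  assert (Hj : forall a t, 0 <= t -> Rbar_lt t T -> jac a t <> 0).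
  { intros a t Ht HtT. apply Rgt_not_eq, hjac; assumption. }
  split.
  - apply continuous_strip_lift, hG.
  - intros x t Ht HtT. eexists. apply is_derive_lift_dx; assumption.
  - assert (H : continuous_strip T (fun x t => Ga (label x t) t / jac (label x t) t)).
    { apply (continuous_strip_lift (fun a t => Ga a t / jac a t)). intros a t Ht HtT.
      apply filterlim_Rdiv; [apply hGac; assumption | apply jac_continuous | apply Hj; assumption]. }
    (* The formula is known to agree with [dx] only on the strip, so its continuity is transferred
       locally in time. *)
    assert (Heq : forall x t, 0 <= t -> Rbar_lt t T ->
      Ga (label x t) t / jac (label x t) t = dx (fun x t => G (label x t) t) x t).
    { intros x t Ht HtT. symmetry. apply is_derive_unique.
      apply (is_derive_lift_dx x t); assumption. }
    intros x t Ht HtT. rewrite <- Heq by assumption.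
    apply (filterlim_ext_loc (fun p => Ga (label (fst p) (snd p)) (snd p) /
                                       jac (label (fst p) (snd p)) (snd p)));
      [|apply H; assumption].
    destruct (open_Rbar_lt T t HtT) as [d Hd]. exists d. intros [y s] [_ Hs] Hs0.
    apply Heq; [exact Hs0 | apply Hd, Hs].
  - intros x t Ht HtT. eexists. apply is_derive_lift_dt; assumption.
  - assert (H : continuous_strip T (fun x t =>
      Gt (label x t) t - Ga (label x t) t * velocity (label x t) t / jac (label x t) t)).
    { apply (continuous_strip_lift (fun a t => Gt a t - Ga a t * velocity a t / jac a t)).
      intros a t Ht HtT. assert (H1 := hGac a t Ht HtT). assert (H2 := hGtc a t Ht HtT).
      assert (H3 := velocity_continuous a t). assert (H4 := jac_continuous a t).
      unfold continuous in *. limits. apply Hj; assumption. }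
    assert (Heq : forall x t, 0 < t -> Rbar_lt t T ->
      Gt (label x t) t - Ga (label x t) t * velocity (label x t) t / jac (label x t) t =
      dt (fun x t => G (label x t) t) x t).
    { intros x t Ht HtT. symmetry. apply is_derive_unique.
      apply (is_derive_lift_dt x t); assumption. }
    intros x t Ht HtT. unfold continuous. cbn [fst snd]. rewrite <- Heq by assumption.
    apply (filterlim_ext_loc (fun p =>
      Gt (label (fst p) (snd p)) (snd p) -
      Ga (label (fst p) (snd p)) (snd p) * velocity (label (fst p) (snd p)) (snd p) /
      jac (label (fst p) (snd p)) (snd p))).
    + destruct (Rbar_lt_locally_pos T t Ht HtT) as [d Hd]. exists d. intros [y s] [_ Hs].
      apply Heq; apply (Hd s Hs).
    + apply filterlim_strip_interior; [exact Ht|]. apply (H x t); [lra | assumption].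
Qed.

End Lift.

Definition rho_sol (x t : R) : R := density (label x t) t.
Definition u_sol (x t : R) : R := velocity (label x t) t.
Definition E_sol (x t : R) : R := force (label x t) t.

Lemma jac_neq_0 (a t : R) : 0 <= t -> Rbar_lt t T -> jac a t <> 0.
Proof. intros Ht HtT. apply Rgt_not_eq, hjac; assumption. Qed.

Lemma is_derive_E_sol (x t : R) : 0 <= t -> Rbar_lt t T ->
  is_derive (fun y => E_sol y t) x (rho_sol x t - c).
Proof.
  intros Ht HtT. eapply is_derive_eq_val.
  - apply (is_derive_lift_dx force (fun a t => rho0 a - c * jac a t)); try assumption.
    intros a s _ _. apply is_derive_force_da; assumption.
  - unfold rho_sol, density. field. apply jac_neq_0; assumption.
Qed.

Lemma C1_strip_rho_sol : C1_strip T rho_sol.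
Proof.
  apply (C1_strip_lift density density_da density_dt); intros a t Ht HtT.
  - apply is_derive_density_da, jac_neq_0; assumption.
  - apply is_derive_density_dt, jac_neq_0; assumption.
  - apply density_continuous, jac_neq_0; assumption.
  - apply density_da_continuous, jac_neq_0; assumption.
  - apply density_dt_continuous, jac_neq_0; assumption.
Qed.

Lemma C1_strip_u_sol : C1_strip T u_sol.
Proof.
  apply (C1_strip_lift velocity jac_dt (fun a t => - (w * w) / c * force a t));
    intros a t Ht HtT.
  - apply is_derive_velocity_da; assumption.
  - apply is_derive_velocity_dt; assumption.
  - apply velocity_continuous.
  - apply jac_dt_continuous.
  - apply velocity_dt_continuous.
Qed.

Lemma smooth_solution_sol (hT : Rbar_lt 0 T) :
  smooth_solution k c rho0 u0 T rho_sol u_sol E_sol flow.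
Proof.
  assert (Hlabel0 : forall x, label x 0 = x).
  { intros x. rewrite <- (flow_0 w c u0 e x) at 1. apply label_flow; [lra | exact hT]. }
  assert (Hrx : forall x t, 0 <= t -> Rbar_lt t T -> is_derive (fun y => rho_sol y t) x
    (density_da (label x t) t / jac (label x t) t)).
  { intros x t Ht HtT. apply (is_derive_lift_dx density density_da); try assumption.
    intros a s Hs HsT. apply is_derive_density_da, jac_neq_0; assumption. }
  assert (Hux : forall x t, 0 <= t -> Rbar_lt t T -> is_derive (fun y => u_sol y t) x
    (jac_dt (label x t) t / jac (label x t) t)).
  { intros x t Ht HtT. apply (is_derive_lift_dx velocity jac_dt); try assumption.
    intros a s Hs HsT. apply is_derive_velocity_da; assumption. }
  split.
  - exact C1_strip_rho_sol.
  - exact C1_strip_u_sol.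
  - intros x. unfold rho_sol, density. rewrite Hlabel0. unfold flow_jac.
    rewrite jacobian_0. field.
  - intros x. unfold u_sol. rewrite Hlabel0. apply velocity_0.
  - intros x t Ht HtT. assert (Ht' := Rlt_le _ _ Ht).
    assert (H1 : dt rho_sol x t = density_dt (label x t) t -
      density_da (label x t) t * velocity (label x t) t / jac (label x t) t).
    { apply is_derive_unique.
      apply (is_derive_lift_dt density density_da density_dt); try assumption;
        intros a s Hs HsT.
      - apply is_derive_density_da, jac_neq_0; assumption.
      - apply is_derive_density_dt, jac_neq_0; assumption.
      - apply density_da_continuous, jac_neq_0; assumption. }
    assert (H2 : dx (fun y s => rho_sol y s * u_sol y s) x t =
      density_da (label x t) t / jac (label x t) t * u_sol x t +
      rho_sol x t * (jac_dt (label x t) t / jac (label x t) t)).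
    { apply is_derive_unique.
      apply (is_derive_mult (fun y => rho_sol y t) (fun y => u_sol y t) x).
      - apply Hrx; assumption.
      - apply Hux; assumption.
      - intros y z. apply Rmult_comm. }
    (* The convective terms cancel, leaving (rho0 / J)_t = - (rho0 / J) (J_t / J), which is the mass
       equation along a characteristic. *)
    rewrite H1, H2. unfold rho_sol, u_sol, density, density_dt.
    field. apply jac_neq_0; assumption.
  - intros x t Ht HtT. assert (Ht' := Rlt_le _ _ Ht).
    assert (H1 : dt u_sol x t = - (w * w) / c * force (label x t) t -
      jac_dt (label x t) t * velocity (label x t) t / jac (label x t) t).
    { apply is_derive_unique.
      apply (is_derive_lift_dt velocity jac_dt (fun a t => - (w * w) / c * force a t));
        try assumption; intros a s Hs HsT.
      - apply is_derive_velocity_da; assumption.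
      - apply is_derive_velocity_dt; assumption.
      - apply jac_dt_continuous. }
    assert (H2 : dx u_sol x t = jac_dt (label x t) t / jac (label x t) t).
    { apply is_derive_unique, Hux; assumption. }
    rewrite H1, H2, hww. unfold u_sol, E_sol. field.
    split; [apply jac_neq_0; assumption | lra].
  - intros x t Ht HtT. apply is_derive_E_sol; [lra | assumption].
  - intros a. split; [apply flow_0|]. split.
    + rewrite <- (flow_0 w c u0 e a) at 2.
      apply (filterlim_filter_le_1 (F := locally 0)); [apply filter_le_within|].
      apply (@ex_derive_continuous R_AbsRing R_NormedModule (flow a) 0).
      eexists. apply is_derive_flow_dt; assumption.
    + intros t Ht HtT. unfold u_sol. rewrite label_flow by (assumption || lra).
      apply is_derive_flow_dt; assumption.
Qed.

(** The labels tend to infinity with x, so the limits of the data carry over. [E_sol] is an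
    antiderivative of rho - c that vanishes at both ends, which settles both integral conditions. *)
Lemma standing_sol : standing c T rho_sol u_sol E_sol.
Proof.
  intros t Ht HtT.
  assert (Hlp : filterlim (fun x => label x t) (Rbar_locally p_infty) (Rbar_locally p_infty)).
  { intros P [M HM]. exists (flow M t). intros x Hx. apply HM, lt_label; assumption. }
  assert (Hlm : filterlim (fun x => label x t) (Rbar_locally m_infty) (Rbar_locally m_infty)).
  { intros P [M HM]. exists (flow M t). intros x Hx. apply HM, label_lt; assumption. }
  assert (Hrho : forall F : (R -> Prop) -> Prop, Filter F ->
    filterlim rho0 F (locally c) -> filterlim (Derive u0) F (locally 0) ->
    filterlim (fun a => density a t) F (locally c)).
  { intros F FF H1 H2. assert (H3 := filterlim_jac_infty F t H1 H2).
    unfold density. eapply filterlim_eq; [limits; lra | field]. }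
  assert (Hcont : forall x, continuous (fun y => rho_sol y t - c) x).
  { intros x. assert (H := continuous_strip_slice T rho_sol (C1_strip_cont _ _ C1_strip_rho_sol)
                             x t Ht HtT).
    unfold continuous in *. limits. }
  assert (HEp : is_lim (fun x => E_sol x t) p_infty 0).
  { apply (filterlim_comp _ _ _ (fun x => label x t) (fun a => force a t) _ _ _ Hlp).
    apply filterlim_force; assumption || typeclasses eauto. }
  assert (HEm : is_lim (fun x => E_sol x t) m_infty 0).
  { apply (filterlim_comp _ _ _ (fun x => label x t) (fun a => force a t) _ _ _ Hlm).
    apply filterlim_force; assumption || typeclasses eauto. }
  split.
  - repeat split.
    + apply (filterlim_comp _ _ _ (fun x => label x t) (fun a => density a t) _ _ _ Hlm).
      apply Hrho; assumption || typeclasses eauto.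
    + apply (filterlim_comp _ _ _ (fun x => label x t) (fun a => density a t) _ _ _ Hlp).
      apply Hrho; assumption || typeclasses eauto.
    + apply (filterlim_comp _ _ _ (fun x => label x t) (fun a => velocity a t) _ _ _ Hlm).
      apply filterlim_velocity; assumption || typeclasses eauto.
    + apply (filterlim_comp _ _ _ (fun x => label x t) (fun a => velocity a t) _ _ _ Hlp).
      apply filterlim_velocity; assumption || typeclasses eauto.
    + replace 0 with (0 - 0) by ring.
      apply (is_RInt_gen_antiderivative _ (fun x => E_sol x t));
        try assumption; try typeclasses eauto.
      intros x. apply is_derive_E_sol; assumption.
  - intros x. replace (E_sol x t) with (E_sol x t - 0) by ring.
    apply (is_RInt_gen_antiderivative _ (fun x => E_sol x t));
      try assumption; try typeclasses eauto.
    + intros y. apply is_derive_E_sol; assumption.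
    + intros P HP. exact (locally_singleton _ _ HP).
Qed.

End Construction.

(** * The threshold condition *)

Section Threshold.
Context (k c : R) (rho0 u0 : R -> R) (hk : k < 0) (hc : 0 < c).
Context (hrho0 : C1_line rho0) (hu0 : C1_line u0) (hpos : forall x, 0 < rho0 x).

Local Notation w := (sqrt (- c * k)).
Local Notation jac := (flow_jac w c rho0 u0).
Local Notation jac_dt := (flow_jac_dt w c rho0 u0).

Definition growth (a : R) : R := Derive u0 a / w + (1 - rho0 a / c).

Lemma frequency_pos : 0 < w.
Proof. apply sqrt_lt_R0. nra. Qed.

Lemma frequency_sqr : w * w = - c * k.
Proof. apply sqrt_sqrt. nra. Qed.

Lemma Derive_u0_eq_critical_plus (a : R) :
  Derive u0 a = critical_slope k c rho0 a + w * growth a.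
Proof.
  unfold critical_slope, growth. pose proof frequency_pos. field. lra.
Qed.

Lemma threshold_iff (a : R) : Derive u0 a >= critical_slope k c rho0 a <-> 0 <= growth a.
Proof.
  rewrite Derive_u0_eq_critical_plus. pose proof frequency_pos. split; intros H'; nra.
Qed.

Lemma scaled_density_pos (a : R) : 0 < rho0 a / c.
Proof. apply Rdiv_lt_0_compat; [apply hpos | exact hc]. Qed.

(** No normalization at infinity: this serves the results along characteristics that depend only on
    differences of [e]. *)
Lemma density_antiderivative : exists e : R -> R, forall x, is_derive e x (rho0 x - c).
Proof.
  exists (RInt (fun x => rho0 x - c) 0). intros x.
  assert (Hc : forall y, continuous (fun x => rho0 x - c) y).
  { intros y. assert (H := C1_line_continuous _ y hrho0). unfold continuous in *. limits. }
  apply (is_derive_RInt (fun x => rho0 x - c) (RInt (fun x => rho0 x - c) 0) 0 x); [|apply Hc].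
  apply filter_forall. intros b. apply (RInt_correct (V := R_CompleteNormedModule)).
  apply (ex_RInt_continuous (V := R_CompleteNormedModule)). auto.
Qed.

Lemma far_field_potential : far_field c rho0 u0 ->
  exists e : R -> R, (forall x, is_derive e x (rho0 x - c)) /\
    is_lim e m_infty 0 /\ is_lim e p_infty 0.
Proof.
  intros (_ & _ & _ & _ & HI). apply is_RInt_gen_line_antiderivative; [|exact HI].
  intros y. assert (H := C1_line_continuous _ y hrho0). unfold continuous in *. limits.
Qed.

(* [u0 / w - e / c] is nondecreasing under the threshold condition and vanishes at both
   ends of the line, so it vanishes identically and the condition holds with equality. *)
Lemma threshold_far_field_equality : far_field c rho0 u0 ->
  (forall a, 0 <= growth a) -> forall a, growth a = 0.
Proof.
  intros Hff Hg. destruct (far_field_potential Hff) as (e & He & Hem & Hep).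
  destruct Hff as (_ & _ & Hum & Hup & _). assert (Hw := frequency_pos).
  set (g := fun a => u0 a / w - e a / c).
  assert (Hd : forall a, is_derive g a (growth a)).
  { intros a. unfold g. assert (H1 := C1_line_is_derive _ a hu0). assert (H2 := He a).
    auto_derive.
    - repeat split; trivial; eexists; eassumption.
    - rewrite (Derive_eta _ _ _ H1), (Derive_eta _ _ _ H2). unfold growth. field. lra. }
  assert (Hmono : forall a b, a <= b -> g a <= g b).
  { intros a b Hab. destruct (MVT_gen g a b growth) as [x [_ Hx]].
    - intros x _. apply Hd.
    - intros x _. apply continuity_pt_filterlim.
      apply (@ex_derive_continuous R_AbsRing R_NormedModule). exists (growth x). apply Hd.
    - specialize (Hg x). nra. }
  assert (Hlim : forall F : (R -> Prop) -> Prop, Filter F ->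
    filterlim u0 F (locally 0) -> filterlim e F (locally 0) -> filterlim g F (locally 0)).
  { intros F FF H1 H2. unfold g. eapply filterlim_eq; [limits; lra | field; lra]. }
  assert (Hgm := Hlim (Rbar_locally m_infty) _ Hum Hem).
  assert (Hgp := Hlim (Rbar_locally p_infty) _ Hup Hep).
  assert (Hg0 : forall a, g a = 0).
  { intros a. apply Rle_antisym.
    - assert (H : Rbar_le (g a) 0); [|exact H].
      apply (filterlim_le (F := Rbar_locally p_infty) (fun _ => g a) g).
      + exists a. intros x Hx. apply Hmono. lra.
      + apply filterlim_const.
      + exact Hgp.
    - assert (H : Rbar_le 0 (g a)); [|exact H].
      apply (filterlim_le (F := Rbar_locally m_infty) g (fun _ => g a)).
      + exists a. intros x Hx. apply Hmono. lra.
      + exact Hgm.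
      + apply filterlim_const. }
  intros a. rewrite <- (is_derive_unique _ _ _ (Hd a)).
  rewrite (Derive_ext g (fun _ => 0) a Hg0). apply Derive_const.
Qed.

(** Equality in the threshold condition reads u0' = w (rho0 / c - 1). This passes the C^1 regularity
    and the limits at infinity of rho0 on to u0', as the construction requires. *)
Lemma global_solution_of_threshold : far_field c rho0 u0 -> (forall a, 0 <= growth a) ->
  exists rho u E X : R -> R -> R,
    smooth_solution k c rho0 u0 p_infty rho u E X /\ standing c p_infty rho u E.
Proof.
  intros Hff Hg. assert (Hg0 := threshold_far_field_equality Hff Hg).
  destruct (far_field_potential Hff) as (e & He & Hem & Hep).
  destruct Hff as (Hrm & Hrp & Hum & Hup & _).
  assert (Hw := frequency_pos). assert (Hww := frequency_sqr).
  assert (Hdu : forall a, w * (rho0 a / c - 1) = Derive u0 a).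
  { intros a. assert (H := Hg0 a). unfold growth in H.
    replace (Derive u0 a) with (w * (Derive u0 a / w)) by (field; lra).
    f_equal. lra. }
  assert (Hdu0 : C1_line (Derive u0)).
  { apply C1_line_intro with (fun a => w * (Derive rho0 a / c)).
    - intros a. apply (is_derive_ext (fun a => w * (rho0 a / c - 1))); [exact Hdu|].
      assert (H := C1_line_is_derive _ a hrho0).
      auto_derive; [eexists; eassumption|]. rewrite (Derive_eta _ _ _ H). field. lra.
    - intros a. assert (H := proj2 (hrho0 a)). unfold continuous in *. limits. lra. }
  assert (Hlim : forall F : (R -> Prop) -> Prop, Filter F ->
    filterlim rho0 F (locally c) -> filterlim (Derive u0) F (locally 0)).
  { intros F FF H. apply (filterlim_ext _ _ Hdu). eapply filterlim_eq; [limits; lra|]. field. lra. }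
  assert (Hjac : forall a t, 0 <= t -> Rbar_lt t p_infty -> 0 < jac a t).
  { intros a t Ht _. apply jacobian_positive; auto using scaled_density_pos. apply Hg. }
  exists (rho_sol c w rho0 u0 e), (u_sol c w u0 e), (E_sol c w u0 e), (flow_map w c u0 e). split.
  - apply smooth_solution_sol; try assumption. exact I.
  - apply standing_sol; try assumption; apply Hlim; assumption || typeclasses eauto.
Qed.

Section GlobalBounds.
Context (rho u E X : R -> R -> R).
Context (hsol : smooth_solution k c rho0 u0 p_infty rho u E X).

Lemma rho_char_global (a t : R) : 0 <= t -> rho (X a t) t = rho0 a / jac a t.
Proof.
  intros Ht. destruct density_antiderivative as [e He].
  apply (rho_char k c w rho0 u0 e p_infty rho u E X);
    auto using frequency_pos, frequency_sqr; exact I.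
Qed.

Lemma u_x_char_global (a t : R) : 0 <= t -> dx u (X a t) t = jac_dt a t / jac a t.
Proof.
  intros Ht. destruct density_antiderivative as [e He].
  apply (u_x_char k c w rho0 u0 e p_infty rho u E X);
    auto using frequency_pos, frequency_sqr; exact I.
Qed.

Lemma threshold_of_global (a : R) : 0 <= growth a.
Proof.
  destruct (Rle_lt_dec 0 (growth a)) as [H | H]; [exact H|]. exfalso.
  destruct (jacobian_reaches_0 w (rho0 a / c) (Derive u0 a) frequency_pos
              (scaled_density_pos a) H) as [t [Ht Hj]].
  destruct density_antiderivative as [e He].
  assert (Hp : 0 < jac a t); [|unfold flow_jac in Hp; lra].
  apply (jac_pos k c w rho0 u0 e p_infty rho u E X);
    auto using frequency_pos, frequency_sqr; exact I.
Qed.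

Lemma rho_tends_to_0 (a : R) : 0 < growth a -> tends_exponentially (fun t => rho (X a t) t) 0.
Proof.
  intros Hg. assert (Hw := frequency_pos). set (m := Rmin 1 (growth a / 2)).
  assert (Hm : 0 < m) by (apply Rmin_glb_lt; lra).
  exists (rho0 a / m), w. split; [exact Hw|]. intros t Ht.
  assert (Hj : m * exp (w * t) <= jac a t)
    by (apply jacobian_exp_growth; auto using scaled_density_pos).
  assert (He := exp_pos (w * t)). assert (Hr := hpos a).
  assert (Hme : 0 < m * exp (w * t)) by nra.
  rewrite Rminus_0_r, rho_char_global by exact Ht.
  rewrite Rabs_pos_eq by (apply Rdiv_le_0_compat; lra).
  replace (- w * t) with (- (w * t)) by ring. rewrite exp_Ropp.
  replace (rho0 a / m * / exp (w * t)) with (rho0 a * / (m * exp (w * t))) by (field; lra).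
  apply Rmult_le_compat_l; [lra|]. apply Rinv_le_contravar; assumption.
Qed.

(** Without the growing mode, J = p + (1 - p) e^{-wt} with p = rho0 / c, so rho0 / J tends to rho0 /
    p = c and the error is c (p - 1) e^{-wt} / J. *)
Lemma rho_tends_to_c (a : R) : growth a = 0 -> tends_exponentially (fun t => rho (X a t) t) c.
Proof.
  intros Hg. assert (Hw := frequency_pos). assert (Hp := scaled_density_pos a).
  set (p := rho0 a / c) in *. set (m := Rmin p 1).
  assert (Hm : 0 < m) by (apply Rmin_glb_lt; lra).
  exists (c * Rabs (p - 1) / m), w. split; [exact Hw|]. intros t Ht.
  assert (Hj : m <= jac a t).
  { assert (H := jacobian_lower_bound w p (Derive u0 a) Hw t Hp (Req_le_sym _ _ Hg) Ht).
    fold (growth a) in H. unfold growth in Hg. fold p in Hg. rewrite Hg in H.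
    unfold flow_jac. fold p m in H |- *. lra. }
  rewrite rho_char_global by exact Ht.
  replace (rho0 a / jac a t - c) with (c * (p - 1) * exp (- w * t) / jac a t).
  - unfold Rdiv. rewrite !Rabs_mult, Rabs_inv, (Rabs_pos_eq c), (Rabs_pos_eq (exp _)),
      (Rabs_pos_eq (jac a t)) by (try apply Rlt_le, exp_pos; lra).
    replace (c * Rabs (p - 1) * / m * exp (- w * t)) with
      (c * Rabs (p - 1) * exp (- w * t) * / m) by ring.
    apply Rmult_le_compat_l.
    + apply Rmult_le_pos; [|left; apply exp_pos].
      apply Rmult_le_pos; [lra | apply Rabs_pos].
    + apply Rinv_le_contravar; assumption.
  - replace (rho0 a) with (p * c) by (unfold p; field; lra).
    assert (HJ : jac a t = p * (1 - exp (- w * t)) + exp (- w * t)).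
    { unfold flow_jac. rewrite jacobian_modes by exact Hw. unfold growth in Hg. fold p in Hg |- *.
      rewrite Hg. replace (- w * t) with (- (w * t)) by ring. ring. }
    apply Rmult_eq_reg_r with (jac a t); [|lra].
    field_simplify; [|lra|lra]. rewrite HJ. ring.
Qed.

Lemma u_x_char_bound (a t : R) : 0 <= growth a -> 0 <= t ->
  Rabs (dx u (X a t) t) <=
    w * (1 + (Rabs (1 - rho0 a / c) + growth a) / Rmin (rho0 a / c) 1).
Proof.
  intros Hg Ht. assert (Hw := frequency_pos). assert (Hp := scaled_density_pos a).
  rewrite u_x_char_global by exact Ht.
  assert (Hj : 0 < jac a t) by (apply jacobian_positive; assumption).
  unfold Rdiv at 1. rewrite Rabs_mult, Rabs_inv, (Rabs_pos_eq (jac a t)) by lra.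
  apply Rmult_le_reg_r with (jac a t); [exact Hj|].
  rewrite Rmult_assoc, Rinv_l, Rmult_1_r by lra.
  apply jacobian_dt_le_jacobian; assumption.
Qed.

End GlobalBounds.

Lemma far_field_initial (T : Rbar) (rho u E X : R -> R -> R) : Rbar_lt 0 T ->
  smooth_solution k c rho0 u0 T rho u E X -> standing c T rho u E -> far_field c rho0 u0.
Proof.
  intros HT Hsol Hst. destruct (Hst 0 (Rle_refl 0) HT) as [H _].
  replace rho0 with (fun x => rho x 0).
  - replace u0 with (fun x => u x 0); [exact H|].
    apply functional_extensionality, (sol_u_init _ _ _ _ _ _ _ _ _ Hsol).
  - apply functional_extensionality, (sol_rho_init _ _ _ _ _ _ _ _ _ Hsol).
Qed.

(** With zero growth the bound on each characteristic involves |1 - p| / min (p, 1), that is |1 - p|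
    or |1 / p - 1|. Both are continuous in the label with limits at the two ends, hence bounded, and
    every point (x, t) lies on a characteristic. *)
Lemma u_x_uniform_bound (rho u E X : R -> R -> R) :
  smooth_solution k c rho0 u0 p_infty rho u E X -> standing c p_infty rho u E ->
  (forall a, 0 <= growth a) ->
  exists M, forall x t, 0 <= t -> Rabs (dx u x t) <= M.
Proof.
  intros Hsol Hst Hg. assert (Hw := frequency_pos).
  assert (Hff := far_field_initial p_infty rho u E X I Hsol Hst).
  assert (Hg0 := threshold_far_field_equality Hff Hg).
  destruct (far_field_potential Hff) as (e & He & Hem & Hep).
  destruct Hff as (Hrm & Hrp & Hum & Hup & _).
  assert (Hlim1 : forall F : (R -> Prop) -> Prop, Filter F ->
    filterlim rho0 F (locally c) -> filterlim (fun a => 1 - rho0 a / c) F (locally (1 - c / c))).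
  { intros F FF H. limits. lra. }
  assert (Hlim2 : forall F : (R -> Prop) -> Prop, Filter F ->
    filterlim rho0 F (locally c) -> filterlim (fun a => c / rho0 a - 1) F (locally (c / c - 1))).
  { intros F FF H. limits. lra. }
  destruct (bounded_of_is_lim (fun a => 1 - rho0 a / c) (1 - c / c) (1 - c / c)) as [M1 HM1].
  { intros a. assert (H := C1_line_continuous _ a hrho0). unfold continuous in *. limits. lra. }
  { apply Hlim1; [typeclasses eauto | assumption]. }
  { apply Hlim1; [typeclasses eauto | assumption]. }
  destruct (bounded_of_is_lim (fun a => c / rho0 a - 1) (c / c - 1) (c / c - 1)) as [M2 HM2].
  { intros a. assert (H := C1_line_continuous _ a hrho0). assert (Ha := hpos a).
    unfold continuous in *. limits. lra. }
  { apply Hlim2; [typeclasses eauto | assumption]. }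
  { apply Hlim2; [typeclasses eauto | assumption]. }
  exists (w * (1 + (M1 + M2))). intros x t Ht.
  destruct (char_surjective k c w rho0 u0 e p_infty rho u E X) with (x := x) (t := t)
    as [a <-]; auto using frequency_sqr; try exact I.
  eapply Rle_trans; [apply (u_x_char_bound rho u E X Hsol a t (Hg a) Ht)|].
  apply Rmult_le_compat_l; [lra|]. apply Rplus_le_compat_l.
  rewrite Hg0, Rplus_0_r. specialize (HM1 a). specialize (HM2 a). assert (Ha := hpos a).
  assert (Hp := scaled_density_pos a).
  apply Rmin_case.
  - replace (Rabs (1 - rho0 a / c) / (rho0 a / c)) with (Rabs (c / rho0 a - 1)).
    + pose proof (Rabs_pos (1 - rho0 a / c)). lra.
    + replace (c / rho0 a - 1) with ((1 - rho0 a / c) * / (rho0 a / c)) by (field; lra).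
      rewrite Rabs_mult, Rabs_inv, (Rabs_pos_eq (rho0 a / c)) by lra. reflexivity.
  - pose proof (Rabs_pos (c / rho0 a - 1)). lra.
Qed.

End Threshold.

(** * The maximal time of existence *)

Section LifeSpan.
Context (c w : R) (rho0 u0 : R -> R) (hw : 0 < w) (hc : 0 < c).
Context (hrho0 : C1_line rho0) (hu0 : C1_line u0).
Context (hrho0p : is_lim rho0 p_infty c) (hrho0m : is_lim rho0 m_infty c).
Context (hdu0p : is_lim (Derive u0) p_infty 0) (hdu0m : is_lim (Derive u0) m_infty 0).

Local Notation jac := (flow_jac w c rho0 u0).
Local Notation jac_dt := (flow_jac_dt w c rho0 u0).

(** Uniformity in the label is the point. [1 / jac] at t0 is continuous and tends to 1 at both ends,
    so [jac] is bounded below by some 1/M there; the coefficients of cosh and sinh are bounded as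
    well. *)
Lemma jac_pos_extends (t0 : R) : (forall a, 0 < jac a t0) ->
  exists d, 0 < d /\ forall a t, Rabs (t - t0) < d -> 0 < jac a t.
Proof.
  intros Hpos.
  destruct (bounded_of_is_lim (fun a => 1 / jac a t0) (1 / 1) (1 / 1)) as [M HM].
  { intros a. assert (H1 := C1_line_continuous _ a hrho0). assert (H2 := proj2 (hu0 a)).
    assert (Hj : jac a t0 <> 0) by (apply Rgt_not_eq, Hpos).
    unfold continuous, flow_jac, jacobian in *. limits; lra. }
  { assert (H := filterlim_jac_infty c w rho0 u0 hw hc (Rbar_locally m_infty) t0 hrho0m hdu0m).
    apply filterlim_Rdiv; [apply filterlim_const | exact H | lra]. }
  { assert (H := filterlim_jac_infty c w rho0 u0 hw hc (Rbar_locally p_infty) t0 hrho0p hdu0p).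
    apply filterlim_Rdiv; [apply filterlim_const | exact H | lra]. }
  destruct (bounded_of_is_lim (fun a => 1 - rho0 a / c) (1 - c / c) (1 - c / c)) as [M1 HM1].
  { intros a. assert (H1 := C1_line_continuous _ a hrho0). unfold continuous in *. limits. lra. }
  { unfold is_lim in *. limits. lra. }
  { unfold is_lim in *. limits. lra. }
  destruct (bounded_of_is_lim (fun a => Derive u0 a / w) (0 / w) (0 / w)) as [M2 HM2].
  { intros a. assert (H2 := proj2 (hu0 a)). unfold continuous in *. limits. lra. }
  { unfold is_lim in *. limits. lra. }
  { unfold is_lim in *. limits. lra. }
  assert (HM0 : 0 < M).
  { eapply Rlt_le_trans; [|apply (HM 0)]. apply Rabs_pos_lt.
    apply Rgt_not_eq, Rdiv_lt_0_compat; [lra | apply Hpos]. }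
  assert (HM10 : 0 <= M1) by (eapply Rle_trans; [apply Rabs_pos | apply (HM1 0)]).
  assert (HM20 : 0 <= M2) by (eapply Rle_trans; [apply Rabs_pos | apply (HM2 0)]).
  (* The change of J is at most (M1 + M2) eps, strictly less than (M1 + M2 + 1) eps = 1/M; the [+ 1]
     also covers M1 = M2 = 0. *)
  set (eps := / (M * (M1 + M2 + 1))).
  assert (Heps : 0 < eps) by (apply Rinv_0_lt_compat; nra).
  destruct (proj1 (continuous_R_spec _ _) (cosh_scal_continuous w t0) eps Heps)
    as [d1 [Hd1 H1]].
  destruct (proj1 (continuous_R_spec _ _) (sinh_scal_continuous w t0) eps Heps)
    as [d2 [Hd2 H2]].
  exists (Rmin d1 d2). split; [apply Rmin_glb_lt; assumption|]. intros a t Ht.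
  assert (Hc1 := H1 t (Rlt_le_trans _ _ _ Ht (Rmin_l _ _))).
  assert (Hs1 := H2 t (Rlt_le_trans _ _ _ Ht (Rmin_r _ _))).
  cbv beta in Hc1, Hs1.
  set (C := cosh (w * t) - cosh (w * t0)) in *. set (S := sinh (w * t) - sinh (w * t0)) in *.
  assert (Hdiff : jac a t = jac a t0 + ((1 - rho0 a / c) * C + Derive u0 a / w * S)).
  { unfold flow_jac, jacobian, C, S. ring. }
  assert (Hlow : / M <= jac a t0).
  { specialize (HM a). specialize (Hpos a). unfold Rdiv in HM.
    rewrite Rmult_1_l, Rabs_pos_eq in HM by (left; apply Rinv_0_lt_compat, Hpos).
    rewrite <- (Rinv_inv (jac a t0)). apply Rinv_le_contravar; [|exact HM].
    apply Rinv_0_lt_compat, Hpos. }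
  assert (Hsmall : Rabs ((1 - rho0 a / c) * C + Derive u0 a / w * S) <= (M1 + M2) * eps).
  { eapply Rle_trans; [apply Rabs_triang|]. rewrite !Rabs_mult, Rmult_plus_distr_r.
    apply Rplus_le_compat; apply Rmult_le_compat; try apply Rabs_pos; try lra.
    - apply HM1.
    - apply HM2. }
  assert (HMe : / M = (M1 + M2 + 1) * eps) by (unfold eps; field; lra).
  pose proof (Rcomplements.Rabs_maj2 ((1 - rho0 a / c) * C + Derive u0 a / w * S)). lra.
Qed.

(** On the noncompact line, zeros of J could occur at times decreasing to Tb with labels escaping to
    infinity. [jac_pos_extends] excludes this: positivity at Tb for all labels would persist beyond
    the supremum. *)
Lemma first_vanishing_time : (exists a t, 0 <= t /\ jac a t <= 0) ->
  exists Tb, (forall a t, 0 <= t -> t < Tb -> 0 < jac a t) /\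
    exists a, 0 <= Tb /\ jac a Tb = 0.
Proof.
  intros (a1 & t1 & Ht1 & Hj1).
  set (S := fun t => 0 <= t /\ forall a s, 0 <= s <= t -> 0 < jac a s).
  assert (HS0 : S 0).
  { split; [lra|]. intros a s Hs. replace s with 0 by lra. unfold flow_jac.
    rewrite jacobian_0. lra. }
  assert (Hb : forall t, S t -> t <= t1).
  { intros t [Ht H]. destruct (Rle_lt_dec t t1) as [Hle | Hlt]; [exact Hle|].
    specialize (H a1 t1 (conj Ht1 (Rlt_le _ _ Hlt))). lra. }
  destruct (completeness S) as [Tb [Hub Hlub]].
  { exists t1. intros t Ht. apply Hb, Ht. }
  { exists 0. exact HS0. }
  assert (HTb : 0 <= Tb) by (apply Hub, HS0).
  assert (Hbefore : forall a t, 0 <= t -> t < Tb -> 0 < jac a t).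
  { intros a t Ht HtTb. destruct (Rlt_le_dec 0 (jac a t)) as [H | H]; [exact H|].
    exfalso. apply (Rlt_not_le _ _ HtTb). apply Hlub. intros s [Hs HsS].
    destruct (Rle_lt_dec s t) as [Hle | Hlt]; [exact Hle|].
    specialize (HsS a t (conj Ht (Rlt_le _ _ Hlt))). lra. }
  exists Tb. split; [exact Hbefore|].
  apply NNPP. intros Hno.
  (* A negative value at Tb would by continuity be preceded by negative values, against [Hbefore];
     when Tb = 0 the value is 1. *)
  assert (HposTb : forall a, 0 < jac a Tb).
  { intros a. destruct (Rtotal_order 0 (jac a Tb)) as [H | [H | H]]; [exact H | |].
    - exfalso. apply Hno. exists a. auto.
    - exfalso.
      assert (Hc : continuous (jac a) Tb)
        by apply continuity_pt_filterlim, continuity_jacobian, hw.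
      destruct (proj1 (continuous_R_spec _ _) Hc (- jac a Tb)) as [d [Hd Hcont]]; [lra|].
      destruct HTb as [HTb | HTb].
      + set (s := Rmax 0 (Tb - d / 2)).
        assert (Hs : 0 <= s < Tb /\ Tb - d / 2 <= s).
        { unfold s. split; [|apply Rmax_r]. split; [apply Rmax_l|].
          apply Rmax_lub_lt; lra. }
        assert (Hs1 := Hbefore a s (proj1 (proj1 Hs)) (proj2 (proj1 Hs))).
        assert (Hs2 : Rabs (jac a s - jac a Tb) < - jac a Tb).
        { apply Hcont. apply Rabs_def1; lra. }
        apply Rabs_def2 in Hs2. lra.
      + rewrite <- HTb in H. assert (H0 := proj2 HS0 a 0 (conj (Rle_refl 0) (Rle_refl 0))). lra. }
  destruct (jac_pos_extends Tb HposTb) as [d [Hd Hext]].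
  assert (HS : S (Tb + d / 2)).
  { split; [lra|]. intros a s Hs. destruct (Rlt_le_dec s Tb) as [Hlt | Hle].
    - apply Hbefore; lra.
    - apply Hext, Rabs_def1; lra. }
  specialize (Hub _ HS). lra.
Qed.

Lemma density_unbounded_at_vanishing (a Tb : R) : 0 < rho0 a -> 0 < Tb -> jac a Tb = 0 ->
  (forall t, 0 <= t -> t < Tb -> 0 < jac a t) ->
  unbounded_before Tb (fun t => rho0 a / jac a t).
Proof.
  intros Hr HTb H0 Hbefore M.
  assert (Hc : continuous (jac a) Tb) by apply continuity_pt_filterlim, continuity_jacobian, hw.
  (* [M] is arbitrary and may be negative, while the division below needs a positive bound above
     it. *)
  set (M' := Rabs M + 1). assert (HM' : 0 < M') by (pose proof (Rabs_pos M); unfold M'; lra).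
  destruct (proj1 (continuous_R_spec _ _) Hc (rho0 a / M')) as [d [Hd Hcont]].
  { apply Rdiv_lt_0_compat; assumption. }
  set (s := Rmax 0 (Tb - d / 2)).
  assert (Hs : 0 <= s < Tb /\ Tb - d / 2 <= s).
  { unfold s. split; [|apply Rmax_r]. split; [apply Rmax_l|]. apply Rmax_lub_lt; lra. }
  exists s. split; [apply Hs|].
  assert (Hj := Hbefore s (proj1 (proj1 Hs)) (proj2 (proj1 Hs))).
  assert (Hlt : Rabs (jac a s - jac a Tb) < rho0 a / M') by (apply Hcont, Rabs_def1; lra).
  rewrite H0, Rminus_0_r, Rabs_pos_eq in Hlt by lra.
  rewrite Rabs_pos_eq by (apply Rdiv_le_0_compat; lra).
  apply Rlt_trans with M'; [unfold M'; pose proof (Rle_abs M); lra|].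
  apply Rmult_lt_reg_r with (jac a s); [exact Hj|].
  replace (rho0 a / jac a s * jac a s) with (rho0 a) by (field; lra).
  apply Rmult_lt_compat_l with (r := M') in Hlt; [|exact HM'].
  replace (M' * (rho0 a / M')) with (rho0 a) in Hlt by (field; lra). exact Hlt.
Qed.

(* Were the logarithmic derivative of [jac a] bounded below by [- M], the function
   [jac a t * exp (M t)] would be nondecreasing, from the value 1 at time 0. *)
Lemma log_derivative_unbounded_at_vanishing (a Tb : R) : 0 < Tb -> jac a Tb = 0 ->
  (forall t, 0 <= t -> t < Tb -> 0 < jac a t) ->
  unbounded_before Tb (fun t => jac_dt a t / jac a t).
Proof.
  intros HTb H0 Hbefore M. apply NNPP. intros Hno.
  assert (Hle : forall t, 0 <= t < Tb -> - M * jac a t <= jac_dt a t).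
  { intros t Ht. assert (Hj := Hbefore t (proj1 Ht) (proj2 Ht)).
    assert (HM : Rabs (jac_dt a t / jac a t) <= M).
    { apply Rnot_lt_le. intros H. apply Hno. exists t. auto. }
    apply Rcomplements.Rabs_le_between in HM.
    replace (jac_dt a t) with (jac_dt a t / jac a t * jac a t) by (field; lra). nra. }
  assert (Hd : forall t, is_derive (fun t => jac a t * exp (M * t)) t
                           ((jac_dt a t + M * jac a t) * exp (M * t))).
  { intros t. assert (H : is_derive (jac a) t (jac_dt a t)) by (apply is_derive_jacobian, hw).
    auto_derive; [exists (jac_dt a t); exact H|].
    rewrite (Derive_eta (fun t => jac a t) _ _ H). ring. }
  destruct (MVT_cor2 (fun t => jac a t * exp (M * t))
    (fun t => (jac_dt a t + M * jac a t) * exp (M * t)) 0 Tb HTb) as [s [Hs Hs0]].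
  { intros t _. apply is_derive_Reals, Hd. }
  cbv beta in Hs. rewrite H0 in Hs.
  assert (H1 : jac a 0 = 1) by apply jacobian_0.
  rewrite H1, Rmult_0_r, exp_0 in Hs.
  assert (Hpos : 0 <= (jac_dt a s + M * jac a s) * exp (M * s)).
  { apply Rmult_le_pos; [|left; apply exp_pos].
    assert (H := Hle s (conj (Rlt_le _ _ (proj1 Hs0)) (proj2 Hs0))). lra. }
  nra.
Qed.

End LifeSpan.

(** * Regularity and decay of the initial slope, read off from one positive time *)

Section InheritedRegularity.
Context (k c w : R) (rho0 u0 e : R -> R) (T : Rbar) (rho u E X : R -> R -> R).
Context (hw : 0 < w) (hc : 0 < c) (hww : w * w = - c * k).
Context (hrho0 : C1_line rho0) (hu0 : C1_line u0) (hpos : forall x, 0 < rho0 x).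
Context (he : forall x, is_derive e x (rho0 x - c)).
Context (hT : Rbar_lt 0 T).
Context (hsol : smooth_solution k c rho0 u0 T rho u E X).
Context (t0 : R) (ht0 : 0 < t0) (ht0T : Rbar_lt t0 T).

Local Notation jac := (flow_jac w c rho0 u0).

Lemma sinh_pos : 0 < sinh (w * t0).
Proof. rewrite <- sinh_0. apply sinh_lt. nra. Qed.

Lemma rho_char_pos (a : R) : 0 < rho (X a t0) t0.
Proof.
  rewrite (rho_char k c w rho0 u0 e T rho u E X) by (assumption || lra).
  apply Rdiv_lt_0_compat; [apply hpos|].
  apply (jac_pos k c w rho0 u0 e T rho u E X); assumption || lra.
Qed.

(* The right-hand side is C^1 in [a], so u0' is C^1 although only its continuity is
   assumed. *)
Lemma Derive_u0_eq (a : R) : Derive u0 a =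
  (rho0 a / rho (X a t0) t0 - rho0 a / c - (1 - rho0 a / c) * cosh (w * t0)) * w / sinh (w * t0).
Proof.
  assert (Hs := sinh_pos). assert (Hr := rho_char_pos a).
  assert (Hj : rho0 a / rho (X a t0) t0 = jac a t0).
  { rewrite <- (rho_char_mul_jac k c w rho0 u0 e T rho u E X) with (a := a) (t := t0)
      by (assumption || lra). field. lra. }
  rewrite Hj. unfold flow_jac, jacobian. field. lra.
Qed.

(** The density at t0 along characteristics has label derivative J rho_x, and J involves u0' only as
    a continuous coefficient; so that density is C^1 in the label, and [Derive_u0_eq] passes this on
    to u0'. *)
Lemma C1_line_Derive_u0 : C1_line (Derive u0).
Proof.
  assert (Hs := sinh_pos). assert (Ht0 := Rlt_le _ _ ht0).
  set (r := fun a => rho (X a t0) t0).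
  assert (Hr : forall a, 0 < r a) by apply rho_char_pos.
  assert (HX : forall a, is_derive (fun b => X b t0) a (jac a t0)).
  { intros a. apply (is_derive_char_da k c w rho0 u0 e T rho u E X); assumption. }
  assert (Hdr : forall a, is_derive r a (jac a t0 * dx rho (X a t0) t0)).
  { intros a. apply (is_derive_comp (fun x => rho x t0) (fun b => X b t0)); [|apply HX].
    apply Derive_correct, (C1_strip_ex_dx _ _ (sol_rho_C1 _ _ _ _ _ _ _ _ _ hsol)); assumption. }
  apply C1_line_intro with (fun a =>
    ((Derive rho0 a * r a - rho0 a * (jac a t0 * dx rho (X a t0) t0)) / (r a * r a)
     - Derive rho0 a / c + Derive rho0 a / c * cosh (w * t0)) * w / sinh (w * t0)).
  - intros a. apply (is_derive_ext (fun a =>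
      (rho0 a / r a - rho0 a / c - (1 - rho0 a / c) * cosh (w * t0)) * w / sinh (w * t0))).
    { intros b. symmetry. apply Derive_u0_eq. }
    assert (H1 := C1_line_is_derive _ a hrho0). assert (H2 := Hdr a). specialize (Hr a).
    auto_derive.
    + repeat split; try (eexists; eassumption). lra.
    + rewrite (Derive_eta _ _ _ H1), (Derive_eta r _ _ H2). field. lra.
  - intros a.
    assert (H1 := proj2 (hrho0 a)). assert (H2 := C1_line_continuous _ a hrho0).
    assert (H3 := C1_line_continuous _ a hu0). assert (H3' := proj2 (hu0 a)).
    assert (H4 : continuous r a).
    { apply (@ex_derive_continuous R_AbsRing R_NormedModule). eexists. apply Hdr. }
    assert (H5 : continuous (fun a => dx rho (X a t0) t0) a).
    { apply (filterlim_comp_continuous (fun a => X a t0) (fun x => dx rho x t0) (X a t0)).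
      - apply (@ex_derive_continuous R_AbsRing R_NormedModule (fun a => X a t0)).
        eexists. apply HX.
      - apply (continuous_strip_slice T (dx rho)); try assumption.
        apply (C1_strip_dx_cont _ _ (sol_rho_C1 _ _ _ _ _ _ _ _ _ hsol)). }
    specialize (Hr a). unfold continuous, flow_jac, jacobian in *.
    limits; try lra. apply Rgt_not_eq, Rmult_lt_0_compat; exact Hr.
Qed.

(** Both densities tend to c, so the bracket tends to 1 - 1 - 0. Here the conditions at infinity at
    a positive time are used. *)
Lemma filterlim_Derive_u0 (F : (R -> Prop) -> Prop) (x : Rbar) {FF : Filter F} :
  filterlim rho0 F (locally c) ->
  filterlim (fun a => X a t0) F (Rbar_locally' x) -> is_lim (fun y => rho y t0) x c ->
  filterlim (Derive u0) F (locally 0).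
Proof.
  intros H0 HX Hr. assert (Hs := sinh_pos).
  assert (Hr' := filterlim_comp _ _ _ _ _ _ _ _ HX Hr). cbv beta in Hr'.
  apply (filterlim_ext (fun a =>
    (rho0 a / rho (X a t0) t0 - rho0 a / c - (1 - rho0 a / c) * cosh (w * t0)) * w
      / sinh (w * t0))).
  { intros a. symmetry. apply Derive_u0_eq. }
  change (Rbar_locally c) with (locally c) in Hr'.
  eapply filterlim_eq; [limits; lra | field; lra].
Qed.

End InheritedRegularity.

Theorem theorem3p2 (k c : R) (rho0 u0 : R -> R) (hk : k < 0) (hc : 0 < c)
    (hrho0 : C1_line rho0) (hu0 : C1_line u0) (hpos : forall x, 0 < rho0 x) :
  (far_field c rho0 u0 ->
    ((exists rho u E X : R -> R -> R,
        smooth_solution k c rho0 u0 p_infty rho u E X /\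
        standing c p_infty rho u E)
     <-> (forall a, Derive u0 a >= critical_slope k c rho0 a)))
  /\
  ((forall a, Derive u0 a >= critical_slope k c rho0 a) ->
    forall rho u E X : R -> R -> R,
      smooth_solution k c rho0 u0 p_infty rho u E X ->
      (forall a,
        (Derive u0 a > critical_slope k c rho0 a ->
          tends_exponentially (fun t => rho (X a t) t) 0) /\
        (Derive u0 a = critical_slope k c rho0 a ->
          tends_exponentially (fun t => rho (X a t) t) c) /\
        (exists M, forall t, 0 <= t -> Rabs (dx u (X a t) t) <= M)) /\
      (standing c p_infty rho u E ->
        exists M, forall x t, 0 <= t -> Rabs (dx u x t) <= M))
  /\
  (~ (forall a, Derive u0 a >= critical_slope k c rho0 a) ->
    forall (T : Rbar) (rho u E X : R -> R -> R),
      Rbar_lt 0 T ->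
      smooth_solution k c rho0 u0 T rho u E X ->
      standing c T rho u E ->
      exists (Tb : R) (rho' u' E' X' : R -> R -> R),
        Rbar_le T Tb /\
        smooth_solution k c rho0 u0 Tb rho' u' E' X' /\
        standing c Tb rho' u' E' /\
        (forall x t, 0 <= t -> Rbar_lt t T ->
          rho' x t = rho x t /\ u' x t = u x t /\
          E' x t = E x t /\ X' x t = X x t) /\
        breaks_down_at Tb rho' u' X').
Proof.
  assert (Hw := frequency_pos k c hk hc). assert (Hww := frequency_sqr k c hk hc).
  set (w := sqrt (- c * k)) in *.
  assert (Hthr := threshold_iff k c rho0 u0 hk hc).
  split; [|split].
  - intros Hff. split.
    + intros (rho & u & E & X & Hsol & _) a. apply Hthr.
      apply (threshold_of_global k c rho0 u0 hk hc hrho0 hu0 hpos rho u E X Hsol).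
    + intros H. apply global_solution_of_threshold; try assumption.
      intros a. apply Hthr, H.
  - intros H rho u E X Hsol. split.
    + intros a. assert (Hcrit := Derive_u0_eq_critical_plus k c rho0 u0 hk hc a).
      fold w in Hcrit. split; [|split].
      * intros Ha. apply (rho_tends_to_0 k c rho0 u0 hk hc hrho0 hu0 hpos rho u E X Hsol). nra.
      * intros Ha. apply (rho_tends_to_c k c rho0 u0 hk hc hrho0 hu0 hpos rho u E X Hsol). nra.
      * eexists. intros t Ht.
        apply (u_x_char_bound k c rho0 u0 hk hc hrho0 hu0 hpos rho u E X Hsol a t); [|exact Ht].
        apply Hthr, H.
    + intros Hst. apply (u_x_uniform_bound k c rho0 u0 hk hc hrho0 hu0 hpos rho u E X Hsol Hst).
      intros a. apply Hthr, H.
  - intros Hnot T rho u E X HT Hsol Hst.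
    assert (Hff := far_field_initial k c rho0 u0 T rho u E X HT Hsol Hst).
    destruct (far_field_potential c rho0 u0 hrho0 Hff) as (e & He & Hem & Hep).
    destruct Hff as (Hrm & Hrp & Hum & Hup & _).
    assert (Hsurj : forall x t, 0 <= t -> Rbar_lt t T -> exists a, X a t = x).
    { apply (char_surjective k c w rho0 u0 e T rho u E X); assumption. }
    assert (Hulim : forall s, 0 <= s -> Rbar_lt s T -> is_lim (fun x => u x s) p_infty 0).
    { intros s Hs HsT. apply (Hst s Hs HsT). }
    assert (HXflow : forall a t, 0 <= t -> Rbar_lt t T -> X a t = flow_map w c u0 e a t).
    { intros a t Ht HtT. apply (char_eq_flow k c w rho0 u0 e T rho u E X); assumption. }
    assert (Ht0 : exists t0 : R, 0 < t0 /\ Rbar_lt t0 T).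
    { destruct T as [r | |]; simpl in HT |- *; [exists (r / 2); lra | exists 1; lra | tauto]. }
    destruct Ht0 as [t0 [Ht0 Ht0T]]. assert (Ht0' := Rlt_le _ _ Ht0).
    destruct (proj1 (Hst t0 Ht0' Ht0T)) as (Hrt0m & Hrt0p & _).
    assert (Hdu0 : C1_line (Derive u0)).
    { apply (C1_line_Derive_u0 k c w rho0 u0 e T rho u E X) with (t0 := t0); assumption. }
    assert (Hdum : is_lim (Derive u0) m_infty 0).
    { apply (filterlim_Derive_u0 k c w rho0 u0 e T rho u E X) with (t0 := t0) (x := m_infty);
        try assumption; try typeclasses eauto.
      apply (is_lim_char_m_infty k c w rho0 u0 e T rho u E X); assumption. }
    assert (Hdup : is_lim (Derive u0) p_infty 0).
    { apply (filterlim_Derive_u0 k c w rho0 u0 e T rho u E X) with (t0 := t0) (x := p_infty);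
        try assumption; try typeclasses eauto.
      apply (is_lim_char_p_infty k c w rho0 u0 e T rho u E X); assumption. }
    assert (Hvan : exists a t, 0 <= t /\ flow_jac w c rho0 u0 a t <= 0).
    { apply not_all_ex_not in Hnot. destruct Hnot as [a Ha]. exists a.
      apply jacobian_reaches_0; [exact Hw | apply scaled_density_pos; assumption|].
      apply Rnot_le_lt. intros H. apply Ha, Hthr, H. }
    destruct (first_vanishing_time c w rho0 u0 Hw hc hrho0 hu0 Hrp Hrm Hdup Hdum Hvan)
      as (Tb & Hbefore & a & HTb & Hzero).
    (* A solution living beyond Tb would have a positive Jacobian at Tb on the characteristic where
       it vanishes. *)
    assert (HTTb : Rbar_le T Tb).
    { apply Rbar_not_lt_le. intros HTbT.
      assert (H : 0 < flow_jac w c rho0 u0 a Tb); [|lra].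
      apply (jac_pos k c w rho0 u0 e T rho u E X); assumption. }
    assert (HTb0 : Rbar_lt 0 Tb) by (apply Rbar_lt_le_trans with T; assumption).
    assert (Hjac : forall a t, 0 <= t -> Rbar_lt t Tb -> 0 < flow_jac w c rho0 u0 a t)
      by exact Hbefore.
    assert (Hlabel : forall a t, 0 <= t -> Rbar_lt t Tb ->
      label c w u0 e (flow_map w c u0 e a t) t = a).
    { apply (label_flow c w rho0 u0 e Tb); assumption. }
    assert (Hst' : standing c Tb (rho_sol c w rho0 u0 e) (u_sol c w u0 e) (E_sol c w u0 e))
      by (apply standing_sol; assumption).
    assert (Hsol' : smooth_solution k c rho0 u0 Tb (rho_sol c w rho0 u0 e) (u_sol c w u0 e)
      (E_sol c w u0 e) (flow_map w c u0 e)) by (apply smooth_solution_sol; assumption).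
    exists Tb, (rho_sol c w rho0 u0 e), (u_sol c w u0 e), (E_sol c w u0 e), (flow_map w c u0 e).
    split; [exact HTTb|]. split; [exact Hsol'|]. split; [exact Hst'|]. split.
    (* Every point lies on a characteristic of the given solution, which is the explicit one, and
       the values along it are prescribed by the data. *)
    + assert (Hrho : forall x t, 0 <= t -> Rbar_lt t T -> rho_sol c w rho0 u0 e x t = rho x t).
      { intros x t Ht HtT. destruct (Hsurj x t Ht HtT) as [b <-].
        rewrite (rho_char k c w rho0 u0 e T rho u E X) by assumption.
        rewrite HXflow by assumption. unfold rho_sol. rewrite Hlabel; [reflexivity | exact Ht |].
        apply Rbar_lt_le_trans with T; assumption. }
      intros x t Ht HtT. split; [|split; [|split]].
      * apply Hrho; assumption.
      * destruct (Hsurj x t Ht HtT) as [b <-].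
        rewrite (u_char k c w rho0 u0 e T rho u E X) by auto.
        rewrite HXflow by assumption. unfold u_sol. rewrite Hlabel; [reflexivity | exact Ht |].
        apply Rbar_lt_le_trans with T; assumption.
      (* The standing condition recovers E from the density by integration from [m_infty], so equal
         densities give equal forces. *)
      * assert (H1 := proj2 (Hst t Ht HtT) x).
        assert (H2 := proj2 (Hst' t Ht (Rbar_lt_le_trans t T Tb HtT HTTb)) x).
        replace (fun xi => rho_sol c w rho0 u0 e xi t - c) with (fun xi => rho xi t - c) in H2.
        { rewrite <- (is_RInt_gen_unique (V := R_CompleteNormedModule) _ _ H1).
          symmetry. apply (is_RInt_gen_unique (V := R_CompleteNormedModule) _ _ H2). }
        apply functional_extensionality. intros y. rewrite Hrho by assumption. reflexivity.
      * symmetry. apply HXflow; assumption.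
    + exists a. split.
      * intros M. destruct (density_unbounded_at_vanishing c w rho0 u0 Hw a Tb) with (M := M)
          as (s & Hs & HM); auto.
        exists s. split; [exact Hs|].
        (* The a priori formula is applied to the constructed solution itself, on its whole life
           span. *)
        rewrite (rho_char k c w rho0 u0 e Tb _ _ _ _ Hw hc Hww hrho0 hu0 hpos He HTb0 Hsol');
          [exact HM | apply Hs | apply Hs].
      * intros M. destruct (log_derivative_unbounded_at_vanishing c w rho0 u0 Hw a Tb)
          with (M := M) as (s & Hs & HM); auto.
        exists s. split; [exact Hs|].
        rewrite (u_x_char k c w rho0 u0 e Tb _ _ _ _ Hw hc Hww hrho0 hu0 hpos He HTb0 Hsol');
          [exact HM | apply Hs | apply Hs].
Qed.
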